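(* Let $Z\subseteq\mathbb{P}^{n_1}\times\cdots\times\mathbb{P}^{n_k}$ be a set of fat points. Then the resolution regularity vector of $R/I_Z$ is \[\underline{r}(R/I_Z)=(r_1,\ldots,r_k),\] where $r_i=\operatorname{reg}(Z_i)$ for $i=1,\ldots,k$ and $Z_i=\pi_i(Z)\subseteq\mathbb{P}^{n_i}$.
   Context: Let $\mathbf{k}$ be an algebraically closed field of characteristic zero and let $n_1,\dots,n_k$ be positive integers. The homogeneous coordinate ring of $\mathbb{P}^{n_1}\times\cdots\times\mathbb{P}^{n_k}$ is $R=\mathbf{k}[x_{1,0},\ldots,x_{1,n_1},\ldots,x_{k,0},\ldots,x_{k,n_k}]$, graded by $\mathbb{N}^k$ with $\deg x_{i,j}=e_i$, the $i$th standard basis vector of $\mathbb{Z}^k$. For a point $P$, $I_P\subseteq R$ is its defining prime ideal. Given distinct points $P_1,\dots,P_s$ ($s\ge1$) and positive integers $m_1,\dots,m_s$, the set (scheme) of fat points $Z=m_1P_1+\cdots+m_sP_s$ is defined by $I_Z=I_{P_1}^{m_1}\cap\cdots\cap I_{P_s}^{m_s}$. Let $\pi_i$ be the projection onto $\mathbb{P}^{n_i}$, let $R_i=\mathbf{k}[x_{i,0},\ldots,x_{i,n_i}]$, and let $I_{P_{ji}}\subseteq R_i$ be the ideal of the point $\pi_i(P_j)$. Then $Z_i=\pi_i(Z)$ is the scheme of fat points in $\mathbb{P}^{n_i}$ defined by $I_{Z_i}=\bigcap_{j=1}^s I_{P_{ji}}^{m_j}\subseteq R_i$, and $\operatorname{reg}(Z_i)$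 is the Castelnuovo-Mumford regularity of the graded ring $R_i/I_{Z_i}$. The resolution regularity vector of a nonzero finitely generated $\mathbb{N}^k$-graded $R$-module $M$ is $\underline{r}(M)=(r_1,\dots,r_k)$, where $r_\ell$ is the maximum of all integers $a_\ell$ such that $\operatorname{Tor}_i^R(M,\mathbf{k})_{(a_1,\ldots,a_\ell+i,\ldots,a_k)}\neq 0$ for some $i\geq0$ and some $a_1,\ldots,a_{\ell-1},a_{\ell+1},\ldots,a_k$. *)

(* Defs.v *)
From HB Require Import structures.
From mathcomp Require Import all_boot all_order all_algebra.
From mathcomp Require Import generic_quotient ring_quotient.
From mathcomp Require Import boolp.
From mathcomp Require Import ssrcomplements freeg mpoly.

Set Implicit Arguments.
Unset Strict Implicit.
Unset Printing Implicit Defensive.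

Import Order.TTheory GRing.Theory Num.Theory.
Local Open Scope ring_scope.
Local Open Scope quotient_scope.

(* Unlike [idealr], an [ideal] may contain 1 and need not be decidable. *)
Record ideal (R : comNzRingType) := Ideal {
  mem_ideal :> R -> Prop;
  ideal0 : mem_ideal 0;
  idealD : forall x y, mem_ideal x -> mem_ideal y -> mem_ideal (x + y);
  idealMl : forall a x, mem_ideal x -> mem_ideal (a * x) }.

Section Ideals.
Variable R : comNzRingType.
Implicit Types (S : R -> Prop) (I : ideal R).

Definition in_span S (f : R) : Prop :=
  exists c : seq (R * R),
    (forall x, x \in c -> S x.2) /\ f = \sum_(x <- c) x.1 * x.2.

Lemma in_span0 S : in_span S 0.
Proof. by exists [::]; rewrite big_nil. Qed.

Lemma in_spanD S f g : in_span S f -> in_span S g -> in_span S (f + g).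
Proof.
move=> [c [cS ->]] [d [dS ->]]; exists (c ++ d); rewrite big_cat; split=> // x.
by rewrite mem_cat => /orP[/cS|/dS].
Qed.

Lemma in_spanMl S a f : in_span S f -> in_span S (a * f).
Proof.
move=> [c [cS ->]]; exists [seq (a * x.1, x.2) | x <- c]; split.
  by move=> _ /mapP[x /cS Sx ->].
by rewrite big_map mulr_sumr; apply: eq_bigr => x _; rewrite mulrA.
Qed.

Definition ideal_gen S : ideal R :=
  Ideal (in_span0 S) (@in_spanD S) (@in_spanMl S).

Definition ideal_exp I (m : nat) : ideal R :=
  ideal_gen (fun f => exists g : 'I_m -> R,
    (forall t, I (g t)) /\ f = \prod_(t < m) g t).

Section Intersection.
Variables (T : Type) (J : T -> ideal R).
Let cap (f : R) : Prop := forall t, J t f.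

Lemma ideal_cap0 : cap 0. Proof. by move=> t; apply: ideal0. Qed.
Lemma ideal_capD x y : cap x -> cap y -> cap (x + y).
Proof. by move=> Jx Jy t; apply: idealD. Qed.
Lemma ideal_capMl a x : cap x -> cap (a * x).
Proof. by move=> Jx t; apply: idealMl. Qed.

Definition ideal_cap : ideal R := Ideal ideal_cap0 ideal_capD ideal_capMl.
End Intersection.

Definition ideal_pred I : pred R := fun f => `[< I f >].

Lemma ideal_pred_zmod_closed I : zmod_closed (ideal_pred I).
Proof.
split=> [|x y /asboolP Ix /asboolP Iy]; apply/asboolP; first exact: ideal0.
by apply: idealD => //; rewrite -mulN1r; apply: idealMl.
Qed.

HB.instance Definition _ I :=
  GRing.isZmodClosed.Build R (ideal_pred I) (ideal_pred_zmod_closed I).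

Definition ideal_zmod I : zmodClosed R :=
  GRing.ZmodClosed.clone R (ideal_pred I) _.

Definition quot_module I : Type := {ideal_quot (ideal_zmod I)}.
HB.instance Definition _ I := GRing.Zmodule.on (quot_module I).

Definition quot_class I (f : R) : quot_module I := \pi_({ideal_quot (ideal_zmod I)}) f.

Definition quot_scale I (a : R) (x : quot_module I) : quot_module I :=
  quot_class I (a * repr (x : {ideal_quot (ideal_zmod I)})).

Lemma quot_classP I f g : quot_class I f = quot_class I g <-> I (f - g).
Proof.
rewrite /quot_class; split=> [/eqP|Ifg]; last apply/eqP.
  by rewrite -Quotient.idealrBE => /asboolP.
by rewrite -Quotient.idealrBE; apply/asboolP.
Qed.

Lemma quot_classD I f g :
  quot_class I (f + g) = quot_class I f + quot_class I g.
Proof. exact: (raddfD (\pi_({ideal_quot (ideal_zmod I)}))). Qed.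

Lemma quot_class_repr I (x : quot_module I) :
  quot_class I (repr (x : {ideal_quot (ideal_zmod I)})) = x.
Proof. exact: reprK. Qed.

Lemma quot_classZ I a f : quot_scale a (quot_class I f) = quot_class I (a * f).
Proof.
apply/quot_classP; rewrite -mulrBr; apply: idealMl.
by apply/quot_classP; rewrite quot_class_repr.
Qed.

Lemma quot_scaleA I a b (x : quot_module I) :
  quot_scale a (quot_scale b x) = quot_scale (a * b) x.
Proof. by rewrite -[x]quot_class_repr !quot_classZ mulrA. Qed.

Lemma quot_scale1 I : left_id 1 (@quot_scale I).
Proof. by move=> x; rewrite -[x]quot_class_repr quot_classZ mul1r. Qed.

Lemma quot_scaleDr I : right_distributive (@quot_scale I) +%R.
Proof.
move=> a x y; rewrite -[x]quot_class_repr -[y]quot_class_repr.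
by rewrite -quot_classD !quot_classZ mulrDr quot_classD.
Qed.

Lemma quot_scaleDl I (x : quot_module I) :
  {morph (@quot_scale I)^~ x : a b / a + b}.
Proof.
by move=> a b; rewrite -[x]quot_class_repr !quot_classZ mulrDl quot_classD.
Qed.

HB.instance Definition _ I := GRing.Zmodule_isLmodule.Build R (quot_module I)
  (@quot_scaleA I) (@quot_scale1 I) (@quot_scaleDr I) (@quot_scaleDl I).

End Ideals.

Section GradedTor.
Variables (K : fieldType) (N : nat) (G : zmodType).
(* [w t] is the degree of the variable ['X_t]. *)
Variable w : 'I_N -> G.
Local Notation R := {mpoly K[N]}.

Definition mnm_wdeg (m : 'X_{1..N}) : G := \sum_(t < N) w t *+ m t.

Definition whomog (g : G) (f : R) : Prop :=
  forall m, m \in msupp f -> mnm_wdeg m = g.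

(* The axioms of a grading are not recorded: only the R-module and its
   homogeneous pieces enter the definition of Tor. *)
Record gmodule := GModule {
  gmod_sort : lmodType R;
  gmod_piece : G -> gmod_sort -> Prop }.

Definition quot_gmodule (I : ideal R) : gmodule :=
  @GModule (quot_module I : lmodType R)
    (fun g x => exists f, whomog g f /\ x = quot_class I f).

(* F_i is the direct sum of the R(- shift i j), j < rank i, seen as row
   vectors; the differential F_(i+1) -> F_i is u |-> u *m diff i, and the
   augmentation F_0 -> M sends the j-th basis vector to aug j. *)
Record gresolution (M : gmodule) := GResolution {
  rank : nat -> nat;
  shift : forall i, 'I_(rank i) -> G;
  aug : 'I_(rank 0) -> gmod_sort M;
  diff : forall i, 'M[R]_(rank i.+1, rank i);
  aug_homog : forall j, gmod_piece (shift j) (aug j);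
  diff_homog : forall i a b, whomog (shift a - shift b) (diff i a b);
  aug_surj : forall x : gmod_sort M,
    exists u : 'rV_(rank 0), x = \sum_j u 0 j *: aug j;
  exact_aug : forall u : 'rV_(rank 0),
    \sum_j u 0 j *: aug j = 0 <-> exists v, u = v *m diff 0;
  exact_diff : forall i (u : 'rV_(rank i.+1)),
    u *m diff i = 0 <-> exists v, u = v *m diff i.+1 }.

(* As K = R/('X_0, ...), the complex F (x)_R K is obtained by keeping only the
   constant coefficients of the differentials. *)
Definition diffK M (F : gresolution M) i : 'M[K]_(rank F i.+1, rank F i) :=
  map_mx (mcoeff 0%MM) (diff F i).

Definition is_cycle M (F : gresolution M) i : 'rV[K]_(rank F i) -> Prop :=
  if i is i'.+1 then fun v => v *m diffK F i' = 0 else fun=> True.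

Definition is_boundary M (F : gresolution M) i (v : 'rV[K]_(rank F i)) : Prop :=
  exists u, v = u *m diffK F i.

Definition has_degree M (F : gresolution M) i g (v : 'rV[K]_(rank F i)) : Prop :=
  forall j, v 0 j != 0 -> shift j = g.

(* Tor_i^R(M, K)_g <> 0.  The homology of F (x)_R K does not depend on the
   graded free resolution F of M. *)
Definition Tor_neq0 (M : gmodule) (i : nat) (g : G) : Prop :=
  exists (F : gresolution M) (v : 'rV[K]_(rank F i)),
    [/\ has_degree g v, is_cycle v & ~ is_boundary v].

End GradedTor.

Definition is_maximum (S : int -> Prop) (r : int) : Prop :=
  S r /\ forall a, S a -> a <= r.

Lemma is_maximum_uniq S r r' : is_maximum S r -> is_maximum S r' -> r = r'.
Proof. by move=> [Sr ler] [Sr' ler']; apply/le_anti; rewrite ler' ?ler. Qed.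

Definition resolution_regularity (K : fieldType) (N k : nat)
    (w : 'I_N -> 'rV[int]_k) (M : gmodule K N 'rV[int]_k) (r : 'rV[int]_k) : Prop :=
  forall l : 'I_k,
    is_maximum (fun a => exists (i : nat) (d : 'rV[int]_k),
      d 0 l = a /\ Tor_neq0 w M i (d + delta_mx 0 l *+ i)) (r 0 l).

Definition std_weight (N : nat) : 'I_N -> int := fun=> 1.

Definition CM_regularity (K : fieldType) (N : nat)
    (M : gmodule K N int) (r : int) : Prop :=
  is_maximum (fun a => exists i : nat, Tor_neq0 (@std_weight N) M i (a + i%:Z)) r.

(* Points of P^n are the lines of K^(n+1). *)
Definition proj (K : fieldType) (n : nat) : Type :=
  {L : {vspace 'rV[K]_n.+1} | \dim L == 1%N}.

Definition represents (K : fieldType) (n : nat) (v : 'rV[K]_n.+1)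
    (P : proj K n) : Prop :=
  v \in sval P /\ v != 0.

(* The ideal generated by the homogeneous forms vanishing on C. *)
Definition forms_ideal (K : fieldType) (N : nat) (G : zmodType)
    (w : 'I_N -> G) (C : ('I_N -> K) -> Prop) : ideal {mpoly K[N]} :=
  ideal_gen (fun f => (exists g, whomog w g f) /\ forall x, C x -> f.@[x] = 0).

Definition proj_ideal (K : fieldType) (n : nat) (P : proj K n) :
    ideal {mpoly K[n.+1]} :=
  forms_ideal (@std_weight n.+1)
    (fun x => exists v, represents v P /\ forall t, x t = v 0 t).

Section MultiProj.
Variables (K : fieldType) (k : nat) (n : 'I_k -> nat).

Definition multiproj : Type := forall i : 'I_k, proj K (n i).

(* The pair of i and j stands for the variable x_(i,j). *)
Definition xvar : finType := {i : 'I_k & 'I_(n i).+1}.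

Definition multi_weight (t : 'I_#|xvar|) : 'rV[int]_k :=
  delta_mx 0 (tag (enum_val t)).

Definition multiproj_ideal (P : multiproj) : ideal {mpoly K[#|xvar|]} :=
  forms_ideal multi_weight
    (fun x => exists v : forall i, 'rV[K]_(n i).+1,
      (forall i, represents (v i) (P i)) /\
      forall t, x t = v (tag (enum_val t)) 0 (tagged (enum_val t))).

Variables (s : nat) (P : 'I_s -> multiproj) (m : 'I_s -> nat).

Definition fat_ideal : ideal {mpoly K[#|xvar|]} :=
  ideal_cap (fun j => ideal_exp (multiproj_ideal (P j)) (m j)).

(* I_(Z_i); the points P_j need not have distinct projections. *)
Definition fat_proj_ideal (i : 'I_k) : ideal {mpoly K[(n i).+1]} :=
  ideal_cap (fun j => ideal_exp (proj_ideal (P j i)) (m j)).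

End MultiProj.

(* Main.v *)
Require Import Defs.
From HB Require Import structures.
From mathcomp Require Import all_boot all_order all_algebra.
From mathcomp Require Import generic_quotient ring_quotient.
From mathcomp Require Import boolp.
From mathcomp Require Import ring zify.
From mathcomp Require Import mpoly.

(** Fix a factor [l], write R for the coordinate ring of the product, S for that of
    the [l]-th factor, I for the ideal of the fat points and I_l for the ideal of
    their projection. Choose a linear form h of S that vanishes at no projected
    point; K is infinite, so the coefficients of h may be the powers of a scalar
    ([general_linear_form]). Let rho be the top degree in which the hyperplane
    section S/(I_l + (h)) is nonzero. Both regularities equal rho, for the same
    three reasons.

    The form h is a nonzerodivisor modulo I, because the powers of the ideal of a
    point are primary. This is seen on the expansion of a form along the point: a
    form lies in the d-th power of the ideal exactly when its expansion starts in
    degree at least d ([ideal_exp_expansion]), and expansions multiply in a domain.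

    Above degree rho in the [l]-th direction R/(I + (h)) vanishes: R is generated
    over S by elements of degree 0 in that direction, and the extension of I_l is
    contained in I ([mem_incl_top]). That rho exists for S follows from the fact
    that h and the ideal of one point generate the irrelevant ideal, so a monomial
    of degree the total multiplicity lies in I_l + (h) ([fat_top_degree]).

    In degree rho some form of S survives in R/(I + (h)) even after killing the
    variables of the other factors, because this further quotient maps onto
    S/(I_l + (h)) ([retr_ideal_exp]).

    It remains to read the regularity off the section ([Tor_maximum]). Let F be any
    graded free resolution. Modulo h its homology is the section, in homological
    degree 0, as h is regular both on R and on R/I. Killing the remaining variables
    one at a time gives long exact sequences: a variable of weight 0 or 1 cannot
    create homology in degree above rho + i in homological degree i
    ([elim_vanish_cons]), while a variable of weight 1 moves a class of degree
    rho + i to a class of degree rho + i + 1 one step higher ([elim_top_cons]).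
    When all variables are dead what is left is Tor. Taking the variables of the
    other factors first, the surviving form of degree rho ends as a nonzero Tor
    class; a resolution to which this applies exists by Dickson's lemma and
    Hilbert's basis theorem ([resolution_exists]). *)

Set Implicit Arguments.
Unset Strict Implicit.
Unset Printing Implicit Defensive.

Import Order.TTheory GRing.Theory Num.Theory.
Local Open Scope ring_scope.

(** * Polynomial rings: homomorphisms and homogeneous components *)

Lemma mpoly_gen_ind (K : comNzRingType) N (Q : {mpoly K[N]} -> Prop) :
  (forall c, Q c%:MP) -> (forall t, Q 'X_t) ->
  (forall p q, Q p -> Q q -> Q (p + q)) ->
  (forall p q, Q p -> Q q -> Q (p * q)) -> forall p, Q p.
Proof.
move=> QC QX QD QM; elim/mpolyind=> [|c m p _ _ Qp].
  by rewrite -(mpolyC0 N K); apply: QC.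
apply: QD => //; rewrite -mul_mpolyC; apply: (QM) => //.
rewrite mpolyXE_id; elim/big_ind: _ => [|p1 p2|t _].
- by rewrite -(mpolyC1 N K); apply: QC.
- exact: QM.
elim: (m t) => [|e IHe]; first by rewrite expr0 -(mpolyC1 N K); apply: QC.
by rewrite exprS; apply: QM.
Qed.

Lemma rmorph_mpoly_congr (K : comNzRingType) N (A : comNzRingType) (J : ideal A)
    (f g : {rmorphism {mpoly K[N]} -> A}) :
  (forall c, f c%:MP = g c%:MP) -> (forall t, J (f 'X_t - g 'X_t)) ->
  forall p, J (f p - g p).
Proof.
move=> fgC fgX; elim/mpoly_gen_ind => [c|t|p q Jp Jq|p q Jp Jq].
- by rewrite fgC subrr; apply: ideal0.
- exact: fgX.
- by rewrite !rmorphD opprD addrACA; apply: idealD.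
rewrite !rmorphM.
have ->: f p * f q - g p * g q = f q * (f p - g p) + g p * (f q - g q) by ring.
by apply: idealD; apply: idealMl.
Qed.

Lemma rmorph_mpoly_eq (K : comNzRingType) N (A : comNzRingType)
    (f g : {rmorphism {mpoly K[N]} -> A}) :
  (forall c, f c%:MP = g c%:MP) -> (forall t, f 'X_t = g 'X_t) -> f =1 g.
Proof.
move=> fgC fgX; elim/mpoly_gen_ind => [c|t|p q Hp Hq|p q Hp Hq] //.
  by rewrite !rmorphD Hp Hq.
by rewrite !rmorphM Hp Hq.
Qed.

Section Homogeneous.
Variables (K : fieldType) (N : nat) (G : zmodType) (w : 'I_N -> G).
Local Notation R := {mpoly K[N]}.
Implicit Types (f p q : R) (g a b : G).

Lemma mnm_wdeg0 : mnm_wdeg w 0%MM = 0.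
Proof. by rewrite /mnm_wdeg big1 // => t _; rewrite mnm0E mulr0n. Qed.

Lemma mnm_wdegD m1 m2 :
  mnm_wdeg w (m1 + m2)%MM = mnm_wdeg w m1 + mnm_wdeg w m2.
Proof.
rewrite /mnm_wdeg -big_split; apply: eq_bigr => t _.
by rewrite mnmDE mulrnDr.
Qed.

Lemma mnm_wdegU t : mnm_wdeg w U_(t)%MM = w t.
Proof.
rewrite /mnm_wdeg (bigD1 t) //= mnm1E eqxx big1 ?addr0 // => s nst.
by rewrite mnm1E eq_sym (negPf nst) mulr0n.
Qed.

Lemma whomog0 g : whomog w g (0 : R).
Proof. by move=> m; rewrite -(mpolyC0 N K) msupp0. Qed.

Lemma whomogC c : whomog w 0 (c%:MP : R).
Proof.
move=> m; rewrite msuppC; case: eqP => // _.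
by rewrite inE => /eqP->; apply: mnm_wdeg0.
Qed.

Lemma whomogX m : whomog w (mnm_wdeg w m) ('X_[m] : R).
Proof. by move=> m'; rewrite msuppX inE => /eqP->. Qed.

Lemma whomogU t : whomog w (w t) ('X_t : R).
Proof. by rewrite -mnm_wdegU; apply: whomogX. Qed.

Lemma whomogD g p q : whomog w g p -> whomog w g q -> whomog w g (p + q).
Proof. by move=> Hp Hq m /msuppD_le; rewrite mem_cat => /orP[/Hp|/Hq]. Qed.

Lemma whomogM a b p q :
  whomog w a p -> whomog w b q -> whomog w (a + b) (p * q).
Proof.
move=> Hp Hq m /msuppM_le /allpairsP[[m1 m2] /= [/Hp <- /Hq <- ->]].
exact: mnm_wdegD.
Qed.

Lemma whomogZ g (c : K) p : whomog w g p -> whomog w g (c *: p).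
Proof. by move=> Hp; rewrite -mul_mpolyC -(add0r g); apply/whomogM/Hp/whomogC. Qed.

Lemma whomogN g p : whomog w g p -> whomog w g (- p).
Proof. by rewrite -scaleN1r; apply: whomogZ. Qed.

Lemma whomog_sum g (T : Type) (r : seq T) (P : pred T) (F : T -> R) :
  (forall x, P x -> whomog w g (F x)) -> whomog w g (\sum_(x <- r | P x) F x).
Proof.
by move=> HF; elim/big_ind: _ => //; [apply: whomog0 | move=> ? ?; apply: whomogD].
Qed.

Definition wcomp g f : R := \sum_(m <- msupp f | mnm_wdeg w m == g) f@_m *: 'X_[m].

Lemma mcoeff_wcomp g f m :
  (wcomp g f)@_m = if mnm_wdeg w m == g then f@_m else 0.
Proof.
rewrite /wcomp raddf_sum /=.
rewrite (eq_bigr (fun x => f@_x * (x == m)%:R)); last first.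
  by move=> x _; rewrite mcoeffZ mcoeffX.
case: (boolP (m \in msupp f)) => [mf|/memN_msupp_eq0 f0].
  rewrite big_mkcond (bigD1_seq m) ?msupp_uniq //= big1 => [|x /negPf->].
    by rewrite eqxx mulr1 addr0.
  by rewrite mulr0 if_same.
rewrite f0 if_same big1 // => x _.
by case: eqP => [->|_]; rewrite ?f0 ?mul0r ?mulr0.
Qed.

Lemma wcomp_is_additive g : {morph wcomp g : x y / x - y >-> x - y}.
Proof.
move=> p q; apply/mpolyP => m; rewrite mcoeffB !mcoeff_wcomp mcoeffB.
by case: eqP; rewrite ?subrr.
Qed.

HB.instance Definition _ g :=
  GRing.isZmodMorphism.Build R R (wcomp g) (wcomp_is_additive g).

Lemma wcompP g f : whomog w g (wcomp g f).
Proof.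
move=> m; rewrite mcoeff_msupp mcoeff_wcomp.
by case: ifP => [/eqP //|_]; rewrite eqxx.
Qed.
Arguments wcompP : clear implicits.

Lemma wcomp_homog a g f : whomog w a f -> wcomp g f = if a == g then f else 0.
Proof.
move=> Hf; apply/mpolyP => m; rewrite mcoeff_wcomp.
case: (boolP (m \in msupp f)) => [/Hf <-|/memN_msupp_eq0 f0].
  by case: eqP => // _; rewrite mcoeff0.
by rewrite f0 if_same; case: eqP; rewrite ?mcoeff0 ?f0.
Qed.

Lemma wcomp_id g f : whomog w g f -> wcomp g f = f.
Proof. by move=> Hf; rewrite (wcomp_homog _ Hf) eqxx. Qed.

Definition wdegs f : seq G := undup [seq mnm_wdeg w m | m <- msupp f].

Lemma sum_wcomp f : f = \sum_(g <- wdegs f) wcomp g f.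
Proof.
apply/mpolyP => m; rewrite raddf_sum /=.
under eq_bigr do rewrite mcoeff_wcomp.
case: (boolP (m \in msupp f)) => [mf|/memN_msupp_eq0 f0]; last first.
  by rewrite f0 big1 // => g _; rewrite if_same.
rewrite (bigD1_seq (mnm_wdeg w m)) ?undup_uniq //=; last first.
  by rewrite mem_undup map_f.
by rewrite eqxx big1 ?addr0 // => g; rewrite eq_sym => /negPf->.
Qed.

Lemma wcompM a g p f :
  whomog w a p -> wcomp g (p * f) = p * wcomp (g - a) f.
Proof.
move=> Hp; rewrite [f in LHS]sum_wcomp [f in RHS]sum_wcomp mulr_sumr !raddf_sum mulr_sumr /=.
apply: eq_bigr => b _.
rewrite (wcomp_homog _ (whomogM Hp (wcompP b f))) (wcomp_homog _ (wcompP b f)).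
by rewrite -[b == _](inj_eq (addrI a)) [a + (g - a)]addrC subrK; case: eqP; rewrite ?mulr0.
Qed.

End Homogeneous.
Arguments wcompP {K N G} w g f _ _.
Arguments whomog0 {K N G} w g _ _.
Arguments whomogU {K N G} w t _ _.
Arguments whomogC {K N G} w c _ _.

Lemma wcomp_map (K : fieldType) (N N' : nat) (G : zmodType) (w : 'I_N -> G)
    (w' : 'I_N' -> G) (u : {additive {mpoly K[N]} -> {mpoly K[N']}}) :
  (forall g f, whomog w g f -> whomog w' g (u f)) ->
  forall g f, wcomp w' g (u f) = u (wcomp w g f).
Proof.
move=> Hu g f; rewrite [f in LHS](sum_wcomp w) [f in RHS](sum_wcomp w).
rewrite (raddf_sum (wcomp w g)) !(raddf_sum u) (raddf_sum (wcomp w' g)) /=.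
apply: eq_bigr => b _.
rewrite (wcomp_homog _ (Hu _ _ (wcompP w b f))) (wcomp_homog _ (wcompP w b f)).
by case: eqP; rewrite ?raddf0.
Qed.

(** The target is only asked for a family of homogeneous parts, so that the
    same statement serves for polynomial rings and for polynomials over them. *)
Lemma rmorph_graded (K : fieldType) (N : nat) (G : zmodType) (w : 'I_N -> G)
    (A : comNzRingType) (Q : G -> A -> Prop) (u : {rmorphism {mpoly K[N]} -> A}) :
  (forall g, Q g 0) -> (forall g x y, Q g x -> Q g y -> Q g (x + y)) ->
  (forall a b x y, Q a x -> Q b y -> Q (a + b) (x * y)) ->
  (forall c, Q 0 (u c%:MP)) -> (forall t, Q (w t) (u 'X_t)) ->
  forall g f, whomog w g f -> Q g (u f).
Proof.
move=> Q0 QD QM QC QX g f Hf; rewrite [f]mpolyE rmorph_sum big_seq.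
elim/big_ind: _ => // [|m mf]; first exact: QD.
rewrite -mul_mpolyC rmorphM -(add0r g); apply: (QM) => //.
rewrite -(Hf m mf) /mnm_wdeg mpolyXE_id rmorph_prod.
apply: (big_ind2 Q) => [|x1 x2 y1 y2|t _]; [|exact: QM|].
  by rewrite -(rmorph1 u) -(mpolyC1 N K).
rewrite rmorphXn; elim: (m t) => [|e IHe]; last by rewrite mulrS exprS; apply: QM.
by rewrite expr0 -(rmorph1 u) -(mpolyC1 N K).
Qed.

Lemma whomog_rmorph (K : fieldType) (N N' : nat) (G : zmodType) (w : 'I_N -> G)
    (w' : 'I_N' -> G) (u : {rmorphism {mpoly K[N]} -> {mpoly K[N']}}) :
  (forall c, u c%:MP = c%:MP) -> (forall t, whomog w' (w t) (u 'X_t)) ->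
  forall g f, whomog w g f -> whomog w' g (u f).
Proof.
move=> uC uX; apply: rmorph_graded => //.
- by move=> g; apply: whomog0.
- by move=> g x y; apply: whomogD.
- by move=> a b x y; apply: whomogM.
- by move=> c; rewrite uC; apply: whomogC.
Qed.

Lemma whomog_coarsen (K : fieldType) (N : nat) (G H : zmodType) (w : 'I_N -> G)
    (phi : {additive G -> H}) g (f : {mpoly K[N]}) :
  whomog w g f -> whomog (phi \o w) (phi g) f.
Proof.
move=> Hf m /Hf <-; rewrite /mnm_wdeg raddf_sum.
by apply: eq_bigr => t _; rewrite raddfMn.
Qed.

(** Substitution as an opaque ring morphism: everything below depends only on its
    values on constants and variables, and rewriting must not unfold it to a sum. *)
Lemma mpoly_hom_exists (K : comNzRingType) N (A : comNzRingType)
    (k : {rmorphism K -> A}) (x : 'I_N -> A) :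
  {u : {rmorphism {mpoly K[N]} -> A} |
     (forall a, u a%:MP = k a) /\ (forall t, u 'X_t = x t)}.
Proof.
exists (mmap k x); split=> [a|t]; first exact: mmapC.
by rewrite [LHS]mmapX mmap1U.
Qed.

Definition mpoly_hom (K : comNzRingType) N (A : comNzRingType)
    (k : {rmorphism K -> A}) (x : 'I_N -> A) : {rmorphism {mpoly K[N]} -> A} :=
  sval (mpoly_hom_exists k x).

Lemma mpoly_homC (K : comNzRingType) N (A : comNzRingType)
    (k : {rmorphism K -> A}) (x : 'I_N -> A) a : mpoly_hom k x a%:MP = k a.
Proof. by case: (svalP (mpoly_hom_exists k x)). Qed.

Lemma mpoly_homX (K : comNzRingType) N (A : comNzRingType)
    (k : {rmorphism K -> A}) (x : 'I_N -> A) t : mpoly_hom k x 'X_t = x t.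
Proof. by case: (svalP (mpoly_hom_exists k x)). Qed.

(** * Killing a linear form and some of the variables *)

Definition principal (A : comNzRingType) (x : A) : ideal A :=
  ideal_gen (fun y => y = x).

Lemma principalP (A : comNzRingType) (x y : A) :
  principal x y <-> exists q, y = x * q.
Proof.
split=> [[c [cx ->]]|[q ->]].
  exists (\sum_(z <- c) z.1); rewrite mulr_sumr.
  by apply: eq_big_seq => z /cx ->; rewrite mulrC.
exists [:: (q, x)]; split; last by rewrite big_seq1 mulrC.
by move=> z; rewrite inE => /eqP->.
Qed.

Section Elimination.
Variables (K : fieldType) (N : nat) (c : 'I_N -> K) (t0 : 'I_N).
Local Notation R := {mpoly K[N]}.
Hypothesis c_t0 : c t0 = 1.

Definition linform : R := \sum_t c t *: 'X_t.

Definition elim_var (T : seq 'I_N) (t : 'I_N) : R :=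
  if t == t0 then - \sum_(s | (s != t0) && (s \notin T)) c s *: 'X_s
  else if t \in T then 0 else 'X_t.

(** The quotient by the linear form and the variables of [T], realised as an
    endomorphism of the polynomial ring: its kernel is that ideal, so that
    congruences of vectors become equations between their images. *)
Definition elim_map (T : seq 'I_N) : {rmorphism R -> R} :=
  mpoly_hom (@mpolyC N K) (elim_var T).

Lemma elim_mapC T a : elim_map T a%:MP = a%:MP.
Proof. exact: mpoly_homC. Qed.

Lemma elim_mapX T t : elim_map T 'X_t = elim_var T t.
Proof. exact: mpoly_homX. Qed.

Lemma elim_mapZ T a p : elim_map T (a *: p) = a *: elim_map T p.
Proof. by rewrite -!mul_mpolyC rmorphM elim_mapC. Qed.

Lemma elim_map_id T t : t \notin T -> t != t0 -> elim_map T 'X_t = 'X_t.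
Proof. by move=> tT tt0; rewrite elim_mapX /elim_var (negPf tT) (negPf tt0). Qed.

Lemma elim_map_comp T T' f : {subset T <= T'} ->
  elim_map T' (elim_map T f) = elim_map T' f.
Proof.
move=> sTT'.
apply: (rmorph_mpoly_eq (f := elim_map T' \o elim_map T) (g := elim_map T')).
  by move=> a /=; rewrite !elim_mapC.
move=> t /=; rewrite elim_mapX {1}/elim_var.
case: (eqVneq t t0) => [->|tt0].
  rewrite elim_mapX /elim_var eqxx rmorphN raddf_sum /= big_mkcond.
  rewrite [in RHS]big_mkcond; congr (- _); apply: eq_bigr => s _.
  case: (eqVneq s t0) => //= st0; case: (boolP (s \in T)) => [/sTT' ->|sT] //=.
  rewrite elim_mapZ elim_mapX /elim_var (negPf st0).
  by case: (s \in T'); rewrite ?scaler0.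
case: (boolP (t \in T)) => [/sTT' tT'|_] //.
by rewrite elim_mapX /elim_var (negPf tt0) tT' raddf0.
Qed.

Lemma elim_map_linform : elim_map [::] linform = 0.
Proof.
rewrite raddf_sum /= (bigD1 t0) //= c_t0 scale1r.
rewrite elim_mapX /elim_var eqxx addrC.
rewrite [X in - X](eq_bigl (fun s => s != t0)); last by move=> s; rewrite andbT.
apply/eqP; rewrite subr_eq0; apply/eqP/eq_bigr => s st0.
by rewrite elim_mapZ elim_map_id.
Qed.

Lemma elim_map0 f : elim_map [::] f = 0 -> exists q, f = linform * q.
Proof.
move=> f0; apply/principalP; rewrite -[f]subr0 -f0.
apply: (rmorph_mpoly_congr (f := idfun) (g := elim_map [::])) => [a|t].
  by rewrite elim_mapC.
rewrite elim_mapX /elim_var /=; case: eqP => [->|_]; last first.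
  by rewrite subrr; apply: (ideal0 (principal linform)).
apply/principalP; exists 1; rewrite mulr1 opprK /linform [in RHS](bigD1 t0) //= c_t0.
by rewrite scale1r; congr (_ + _); apply: eq_bigl => s; rewrite andbT.
Qed.

(** The two substitutions agree modulo [X_t]; since the smaller one is idempotent
    and fixes [X_t], the quotient by [X_t] may be taken before applying it. *)
Lemma elim_map_cons T t f : t \notin T -> t != t0 ->
  elim_map (t :: T) f = 0 -> exists g, elim_map T (f - 'X_t * g) = 0.
Proof.
move=> tT tt0 f0.
have /principalP[g fg]: principal ('X_t : R) (elim_map T f).
  rewrite -[elim_map T f]subr0 -f0.
  apply: rmorph_mpoly_congr => [a|s]; first by rewrite !elim_mapC.
  rewrite !elim_mapX /elim_var !inE; case: (eqVneq s t0) => _.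
    apply/principalP; exists (- (c t)%:MP).
    rewrite (bigD1 t) ?tt0 //= -mul_mpolyC mulrC mulrN.
    rewrite (eq_bigl (fun i => (i != t0) && (i \notin t :: T))); last first.
      by move=> s'; rewrite inE negb_or andbAC -!andbA.
    by rewrite opprK opprD addrNK.
  case: (eqVneq s t) => [->|_] /=; last by rewrite subrr; apply: (ideal0 (principal _)).
  by rewrite (negPf tT); apply/principalP; exists 1; rewrite mulr1 subr0.
exists g; rewrite rmorphB rmorphM (elim_map_id tT tt0).
have := congr1 (elim_map T) fg.
by rewrite elim_map_comp // rmorphM (elim_map_id tT tt0) => ->; rewrite subrr.
Qed.

Lemma elim_map_full T f :
  (forall t, t != t0 -> t \in T) -> elim_map T f = (f@_0%MM)%:MP.
Proof.
move=> HT; apply: (rmorph_mpoly_eq (f := elim_map T)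
  (g := @mpolyC N K \o mcoeff 0%MM)) => [a|t] /=.
  by rewrite elim_mapC mcoeffC eqxx mulr1.
rewrite elim_mapX /elim_var mcoeffX mnm1_eq0 mpolyC0.
case: eqP => [_|/eqP/HT -> //]; rewrite big1 ?oppr0 // => s /andP[/HT ->].
by [].
Qed.

End Elimination.

(** * Homogeneous vectors of a graded free module *)

Section HomogeneousVectors.
Variables (K : fieldType) (N : nat) (G : zmodType) (w : 'I_N -> G).
Local Notation R := {mpoly K[N]}.

Definition vhomog r (sh : 'I_r -> G) (a : G) (u : 'rV[R]_r) : Prop :=
  forall j, whomog w (a - sh j) (u 0 j).

Definition vcomp r (sh : 'I_r -> G) (a : G) (u : 'rV[R]_r) : 'rV[R]_r :=
  \row_j wcomp w (a - sh j) (u 0 j).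

Lemma vcompP r (sh : 'I_r -> G) a u : vhomog sh a (vcomp sh a u).
Proof. by move=> j; rewrite mxE; apply: wcompP. Qed.

Lemma vcomp_id r (sh : 'I_r -> G) a u : vhomog sh a u -> vcomp sh a u = u.
Proof. by move=> Hu; apply/rowP => j; rewrite mxE wcomp_id. Qed.

Lemma vcompB r (sh : 'I_r -> G) a u v :
  vcomp sh a (u - v) = vcomp sh a u - vcomp sh a v.
Proof. by apply/rowP => j; rewrite !mxE raddfB. Qed.

Lemma vcompZ r (sh : 'I_r -> G) a b p u :
  whomog w b p -> vcomp sh a (p *: u) = p *: vcomp sh (a - b) u.
Proof.
by move=> Hp; apply/rowP => j; rewrite !mxE (wcompM _ _ Hp) addrAC.
Qed.

Lemma vcompM r r' (sh : 'I_r -> G) (sh' : 'I_r' -> G) a u (d : 'M[R]_(r, r')) :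
  (forall i j, whomog w (sh i - sh' j) (d i j)) ->
  vcomp sh' a (u *m d) = vcomp sh a u *m d.
Proof.
move=> Hd; apply/rowP => j; rewrite !mxE (raddf_sum (wcomp w _)).
apply: eq_bigr => i _; rewrite mxE /= mulrC (wcompM _ _ (Hd i j)) [RHS]mulrC.
by rewrite opprB addrA subrK.
Qed.

Lemma vhomogB r (sh : 'I_r -> G) a u v :
  vhomog sh a u -> vhomog sh a v -> vhomog sh a (u - v).
Proof. by move=> Hu Hv; rewrite -(vcomp_id Hu) -(vcomp_id Hv) -vcompB; apply: vcompP. Qed.

Lemma vhomogZ r (sh : 'I_r -> G) a b p u :
  whomog w b p -> vhomog sh a u -> vhomog sh (b + a) (p *: u).
Proof. by move=> Hp Hu j; rewrite mxE -addrA; apply: whomogM. Qed.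

Lemma vhomogM r r' (sh : 'I_r -> G) (sh' : 'I_r' -> G) a u (d : 'M[R]_(r, r')) :
  (forall i j, whomog w (sh i - sh' j) (d i j)) ->
  vhomog sh a u -> vhomog sh' a (u *m d).
Proof. by move=> Hd Hu; rewrite -(vcomp_id Hu) -(vcompM _ _ Hd); apply: vcompP. Qed.

Lemma vcomp_map r (sh : 'I_r -> G) a (f : {additive R -> R}) u :
  (forall g p, whomog w g p -> whomog w g (f p)) ->
  vcomp sh a (map_mx f u) = map_mx f (vcomp sh a u).
Proof. by move=> Hf; apply/rowP => j; rewrite !mxE (wcomp_map Hf). Qed.

End HomogeneousVectors.

(** * Homology modulo a linear form and variables *)

Lemma row_choice (A : nzRingType) r (Q : 'I_r -> A -> Prop) :
  (forall j, exists x, Q j x) -> exists v : 'rV[A]_r, forall j, Q j (v 0 j).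
Proof.
move=> /fin_all_exists[f Hf]; exists (\row_j f j) => j.
by rewrite mxE.
Qed.

Section HyperplaneSection.
Variables (K : fieldType) (N : nat) (G : zmodType) (w : 'I_N -> G).
Variables (phi : {additive G -> int}) (c : 'I_N -> K) (t0 : 'I_N).
Local Notation R := {mpoly K[N]}.
Local Notation wphi := (phi \o w).
Local Notation h := (linform c).
Local Notation psi := (elim_map c t0).
Hypothesis c_t0 : c t0 = 1.
Hypothesis c_deg1 : forall t, c t != 0 -> phi (w t) = 1.
Hypothesis deg01 : forall t, phi (w t) = 0 \/ phi (w t) = 1.

Lemma elim_map_homog T a f : whomog wphi a f -> whomog wphi a (psi T f).
Proof.
apply: whomog_rmorph => [b|t]; first exact: elim_mapC.
rewrite elim_mapX /elim_var; case: eqP => [->|_]; last first.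
  by case: ifP => _; [apply: whomog0 | apply: whomogU].
apply: whomogN; apply: whomog_sum => s _.
have [->|cs] := eqVneq (c s) 0; first by rewrite scale0r; apply: whomog0.
apply: whomogZ; rewrite /= [phi (w t0)]c_deg1 ?c_t0 ?oner_eq0 // -(c_deg1 cs).
exact: (whomogU wphi).
Qed.

(** The quotient by [X_t] can be taken homogeneous by keeping only the component
    of the expected degree. *)
Lemma elim_map_cons_vec T t r (sh : 'I_r -> int) a (u : 'rV[R]_r) :
  t \notin T -> t != t0 -> vhomog wphi sh a u -> map_mx (psi (t :: T)) u = 0 ->
  exists v, vhomog wphi sh (a - phi (w t)) v /\
            map_mx (psi T) (u - 'X_t *: v) = 0.
Proof.
move=> tT tt0 Hu u0.
have [j|v Hv] := @row_choice _ r (fun j x => psi T (u 0 j - 'X_t * x) = 0).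
  by apply: elim_map_cons => //; have := congr1 (fun z : 'rV_r => z 0 j) u0; rewrite !mxE.
exists (vcomp wphi sh (a - phi (w t)) v); split; first exact: vcompP.
have vu: map_mx (psi T) (u - 'X_t *: v) = 0.
  by apply/rowP => j; rewrite !mxE Hv.
rewrite -(vcomp_id Hu) -(vcompZ _ _ _ (whomogU wphi t)) -vcompB.
rewrite -vcomp_map ?vu; last exact: elim_map_homog.
by apply/rowP => j; rewrite !mxE raddf0.
Qed.

Variables (I : ideal R) (F : gresolution w (quot_gmodule w I)).
Local Notation sh i := (fun j : 'I_(rank F i) => phi (shift j)).
Local Notation vh i := (vhomog wphi (sh i)).

Lemma diff_homog_phi i a b : whomog wphi (sh i.+1 a - sh i b) (diff F i a b).
Proof. by rewrite -raddfB; apply/whomog_coarsen/diff_homog. Qed.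

Lemma diff_diff i : diff F i.+1 *m diff F i = 0.
Proof.
apply/row_matrixP => j; rewrite row0 row_mul; apply/exact_diff.
by exists (row j 1%:M); rewrite -row_mul mul1mx.
Qed.

Definition elim_cycle T i : 'rV[R]_(rank F i) -> Prop :=
  if i is i'.+1 then fun u => map_mx (psi T) (u *m diff F i') = 0 else fun=> True.

Definition elim_boundary T i (u : 'rV[R]_(rank F i)) : Prop :=
  exists v, map_mx (psi T) (u - v *m diff F i) = 0.

Lemma elim_boundary_homog T i a u : vh i a u -> elim_boundary T u ->
  exists v, vh i.+1 a v /\ map_mx (psi T) (u - v *m diff F i) = 0.
Proof.
move=> Hu [v Hv]; exists (vcomp wphi (sh i.+1) a v); split; first exact: vcompP.
rewrite -(vcomp_id Hu) -(vcompM _ _ (@diff_homog_phi i)) -vcompB.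
rewrite -vcomp_map ?Hv; last exact: elim_map_homog.
by apply/rowP => j; rewrite !mxE raddf0.
Qed.

Lemma map_elim_comp T T' r (u : 'rV[R]_r) : {subset T <= T'} ->
  map_mx (psi T) u = 0 -> map_mx (psi T') u = 0.
Proof.
move=> sTT' u0; apply/rowP => j; have := congr1 (fun z : 'rV_r => z 0 j) u0.
by rewrite !mxE => uj; rewrite -(elim_map_comp c t0 _ sTT') uj raddf0.
Qed.

Lemma map_elimZX T t r (u : 'rV[R]_r) : t \notin T -> t != t0 ->
  map_mx (psi T) ('X_t *: u) = 'X_t *: map_mx (psi T) u.
Proof. by move=> tT tt0; rewrite map_mxZ elim_map_id. Qed.

Variable rho : int.

(** The bound on degrees grows by one with each homological step, as the degree of a
    class does under the connecting map for a variable of weight 1: this makes the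
    condition stable under killing variables. *)
Definition elim_vanish T : Prop := forall i (a : int) (u : 'rV_(rank F i)),
  rho + i%:Z < a -> vh i a u -> elim_cycle T u -> elim_boundary T u.

(** If the differential of [z] is a multiple of [X_t], the quotient is again a
    cycle, because [X_t] is a nonzerodivisor modulo the ideal killed by [psi T]. *)
Lemma cycle_divX T t i (u : 'rV[R]_(rank F i)) (z : 'rV[R]_(rank F i.+1)) :
  t \notin T -> t != t0 -> map_mx (psi T) (z *m diff F i - 'X_t *: u) = 0 ->
  elim_cycle T u.
Proof.
case: i u z => [|i] //= u z tT tt0 Hz.
have /eqP: 'X_t *: map_mx (psi T) (u *m diff F i) = 0.
  have Xu: 'X_t *: (u *m diff F i) =
    - ((z *m diff F i.+1 - 'X_t *: u) *m diff F i).
    by rewrite mulmxBl -mulmxA diff_diff mulmx0 sub0r opprK scalemxAl.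
  by rewrite -map_elimZX // Xu map_mxN map_mxM Hz mul0mx oppr0.
rewrite scalemx_eq0 => /orP[/eqP X0|/eqP //].
by have /eqP := congr1 (mcoeff U_(t)%MM) X0; rewrite mcoeffX eqxx mcoeff0 oner_eq0.
Qed.

(** From the exact sequence 0 -> R/J -> R/J -> R/(J + (X_t)) -> 0: the new
    homology sits between the old one in the same homological degree and the old
    one a degree lower, shifted by the weight of [X_t], which is at most 1. *)
Lemma elim_vanish_cons T t : t \notin T -> t != t0 ->
  elim_vanish T -> elim_vanish (t :: T).
Proof.
move=> tT tt0 VT; have sTt : {subset T <= t :: T} by move=> s sT; rewrite inE sT orbT.
case=> [|i] a u ltra Hu.
  move=> _; have [//|v Hv] := VT 0%N a u ltra Hu.
  by exists v; apply: map_elim_comp Hv.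
move=> /= uT.
have [u' [Hu' uu']] := elim_map_cons_vec tT tt0 (vhomogM (@diff_homog_phi i) Hu) uT.
have cu' := cycle_divX tT tt0 uu'.
have ltra' : rho + i%:Z < a - phi (w t) by case: (deg01 t) => ->; lia.
have [v' [Hv' uv']] := elim_boundary_homog Hu' (VT i _ _ ltra' Hu' cu').
have [||v Hv] := VT i.+1 a (u - 'X_t *: v') ltra.
- apply: vhomogB => //; rewrite -[a](subrK (phi (w t))) addrC.
  exact: vhomogZ (whomogU wphi t) Hv'.
- rewrite /= mulmxBl -scalemxAl.
  have ->: u *m diff F i - 'X_t *: (v' *m diff F i) =
    (u *m diff F i - 'X_t *: u') + 'X_t *: (u' - v' *m diff F i).
    by rewrite scalerBr addrA subrK.
  by rewrite map_mxD uu' map_elimZX // uv' scaler0 addr0.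
exists v; have := map_elim_comp sTt Hv.
rewrite addrAC map_mxB map_mxZ elim_mapX /elim_var (negPf tt0) inE eqxx.
by rewrite scale0r subr0.
Qed.

Definition elim_top T i : Prop := exists u : 'rV_(rank F i),
  [/\ vh i (rho + i%:Z) u, elim_cycle T u & ~ elim_boundary T u].

(** The connecting map: multiplication by [X_t] kills the old homology in the top
    degree, so each class there lifts to a class one homological step higher. *)
Lemma elim_top_cons T t i : t \notin T -> t != t0 -> phi (w t) = 1 ->
  elim_vanish T -> elim_top T i -> elim_top (t :: T) i.+1.
Proof.
move=> tT tt0 wt VT [u [Hu cu nbu]].
have Hxu : vh i (rho + i.+1%:Z) ('X_t *: u).
  have ->: rho + i.+1%:Z = wphi t + (rho + i%:Z) by rewrite /= wt; lia.
  exact: vhomogZ (whomogU wphi t) Hu.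
have cxu : elim_cycle T ('X_t *: u).
  case: i u Hu cu nbu {Hxu} => [|i] //= u Hu cu nbu.
  by rewrite -scalemxAl map_elimZX // cu scaler0.
have ltr : rho + i%:Z < rho + i.+1%:Z by lia.
have [v [Hv xuv]] := elim_boundary_homog Hxu (VT _ _ _ ltr Hxu cxu).
exists v; split=> //.
  have := map_elim_comp (T' := t :: T) _ xuv.
  rewrite map_mxB map_mxZ elim_mapX /elim_var (negPf tt0) inE eqxx scale0r sub0r.
  move=> /(_ _)/eqP; rewrite oppr_eq0 => H; apply/eqP/H.
  by move=> s sT; rewrite inE sT orbT.
move=> [v' Hv'].
have [j|g Hg] := @row_choice _ _
    (fun j x => psi T ((v - v' *m diff F i.+1) 0 j - 'X_t * x) = 0).
  apply: elim_map_cons => //.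
  by have := congr1 (fun z : 'rV_ _ => z 0 j) Hv'; rewrite !mxE.
apply: nbu; exists g; apply/eqP.
rewrite -(inj_eq (_ : injective ( *:%R ('X_t : R)))); last first.
  move=> A B /eqP; rewrite -subr_eq0 -scalerBr scalemx_eq0 => /orP[/eqP X0|].
    by have /eqP := congr1 (mcoeff U_(t)%MM) X0; rewrite mcoeffX eqxx mcoeff0 oner_eq0.
  by rewrite subr_eq0 => /eqP.
rewrite scaler0 -map_elimZX //; apply/eqP.
have vg: map_mx (psi T) (v - v' *m diff F i.+1 - 'X_t *: g) = 0.
  by apply/rowP => j; have := Hg j; rewrite !mxE.
have ->: 'X_t *: (u - g *m diff F i) =
   ('X_t *: u - v *m diff F i) + (v - v' *m diff F i.+1 - 'X_t *: g) *m diff F i.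
  rewrite !mulmxBl -mulmxA diff_diff mulmx0 subr0 addrA subrK.
  by rewrite scalerBr scalemxAl.
by rewrite map_mxD xuv map_mxM vg mul0mx addr0.
Qed.

Lemma quot_class_eq0 p : quot_class I p = 0 <-> I p.
Proof.
have <- : quot_class I 0 = 0.
  by apply: (addrI (quot_class I 0)); rewrite -quot_classD !addr0.
by rewrite quot_classP subr0.
Qed.

(** Homogeneous representatives turn statements on the augmentation into
    statements on membership in [I]. *)
Lemma aug_rep : exists f : 'I_(rank F 0) -> R,
  (forall j, whomog w (shift j) (f j)) /\
  forall u : 'rV_(rank F 0),
    \sum_(j < rank F 0) u 0 j *: aug j = quot_class I (\sum_j u 0 j * f j).
Proof.
have /fin_all_exists[f Hf]:
  forall j : 'I_(rank F 0), exists p, whomog w (shift j) p /\ aug j = quot_class I p.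
  by move=> j; have := aug_homog j.
exists f; split=> [j|u]; first by case: (Hf j).
have classS (r : seq 'I_(rank F 0)) (p : 'I_(rank F 0) -> R) :
    quot_class I (\sum_(j <- r) p j) = \sum_(j <- r) quot_class I (p j).
  elim: r => [|j r IHr]; last by rewrite !big_cons quot_classD IHr.
  by rewrite !big_nil; apply: (addrI (quot_class I 0)); rewrite -quot_classD !addr0.
rewrite classS; apply: eq_bigr => j _.
by case: (Hf j) => _ ->; apply: quot_classZ.
Qed.

Hypothesis h_regular : forall f, I (h * f) -> I f.
Hypothesis top_bound : forall (a : int) f,
  rho < a -> whomog wphi a f -> exists q, I (f - h * q).

Lemma map_elim0 r (u : 'rV[R]_r) :
  map_mx (psi [::]) u = 0 -> exists v, u = h *: v.
Proof.
move=> u0; have [j|v Hv] := @row_choice _ r (fun j x => u 0 j = h * x).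
  by apply: (elim_map0 c_t0); have := congr1 (fun z : 'rV_r => z 0 j) u0; rewrite !mxE.
by exists v; apply/rowP => j; rewrite mxE.
Qed.

Lemma map_elimZh r (u : 'rV[R]_r) : map_mx (psi [::]) (h *: u) = 0.
Proof. by rewrite map_mxZ (elim_map_linform c_t0) scale0r. Qed.

Lemma linform_neq0 : h != 0.
Proof.
apply/negP => /eqP /(congr1 (mcoeff U_(t0)%MM)) /eqP.
rewrite raddf_sum mcoeff0 (bigD1 t0) //= mcoeffZ mcoeffXU eqxx mulr1 c_t0.
rewrite big1 ?addr0 ?oner_eq0 // => t /negPf tt0.
by rewrite mcoeffZ mcoeffXU tt0 mulr0.
Qed.

(** Modulo [h] alone, the regularity of [h] on the module concentrates the
    homology in homological degree 0, where it is the hyperplane section. *)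
Lemma elim_vanish_nil : elim_vanish [::].
Proof.
have [f [Hf augE]] := aug_rep.
have augB (u v : 'rV[R]_(rank F 0)) : \sum_(j < rank F 0) (u - h *: v) 0 j *: aug j =
    quot_class I (\sum_j u 0 j * f j - h * \sum_j v 0 j * f j).
  rewrite augE; congr (quot_class I _).
  by rewrite mulr_sumr -sumrB; apply: eq_bigr => j _; rewrite !mxE mulrBl mulrA.
case=> [|[|i]] a u ltra Hu /=.
- move=> _; have [||q Iq] := @top_bound a (\sum_j u 0 j * f j).
  + by rewrite addr0 in ltra.
  + apply: whomog_sum => j _; rewrite -[a](subrK (phi (shift j))).
    by apply: whomogM (Hu j) _; apply: whomog_coarsen.
  have [v] := aug_surj F (quot_class I q); rewrite augE => /quot_classP Iqv.
  have [v' uv] : exists v', u - h *: v = v' *m diff F 0.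
    apply/exact_aug; rewrite augB; apply/quot_class_eq0.
    have -> : \sum_j u 0 j * f j - h * \sum_j v 0 j * f j =
      (\sum_j u 0 j * f j - h * q) + h * (q - \sum_j v 0 j * f j) by ring.
    by apply: idealD => //; apply: idealMl.
  by exists v'; rewrite -uv opprB addrC subrK map_elimZh.
- move=> /map_elim0[u' uu'].
  have [v' u'v'] : exists v', u' = v' *m diff F 0.
    apply/exact_aug; rewrite augE; apply/quot_class_eq0/h_regular/quot_class_eq0.
    have /exact_aug : exists v, 0 - h *: u' = v *m diff F 0.
      by exists (- u); rewrite sub0r mulNmx uu'.
    rewrite augB big1 => [|j _]; last by rewrite mxE mul0r.
    rewrite sub0r => /quot_class_eq0 Iu; apply/quot_class_eq0.
    by rewrite -[_ * _]opprK -mulN1r; apply: idealMl.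
  have [v Hv] : exists v, u - h *: v' = v *m diff F 1.
    by apply/exact_diff; rewrite mulmxBl uu' -scalemxAl -u'v' subrr.
  by exists v; rewrite -Hv opprB addrC subrK map_elimZh.
- move=> /map_elim0[u' uu'].
  have [v' u'v'] : exists v', u' = v' *m diff F i.+1.
    apply/exact_diff/eqP; rewrite -[_ == 0]orFb -(negPf linform_neq0).
    by rewrite -scalemx_eq0 scalemxAl -uu' -mulmxA diff_diff mulmx0.
  have [v Hv] : exists v, u - h *: v' = v *m diff F i.+2.
    by apply/exact_diff; rewrite mulmxBl uu' -scalemxAl -u'v' subrr.
  by exists v; rewrite -Hv opprB addrC subrK map_elimZh.
Qed.

Lemma elim_vanishP T : uniq (t0 :: T) -> elim_vanish T.
Proof.
elim: T => [|t T IHT]; first by move=> _; apply: elim_vanish_nil.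
rewrite /= inE negb_or => /andP[/andP[t0t t0T] /andP[tT uT]].
by apply: elim_vanish_cons; rewrite // 1?eq_sym //; apply: IHT; rewrite /= t0T.
Qed.

Hypothesis I_homog : forall a p, I p -> I (wcomp wphi a p).

(** A form outside I + (h) + (X_T) is a nonzero class of degree [rho] in the
    homology in homological degree 0. *)
Lemma elim_top0 T f : whomog wphi rho f ->
  (forall p, I p -> psi T (f - p) <> 0) -> elim_top T 0.
Proof.
move=> Hf nf; have [e [He augE]] := aug_rep.
have [u0] := aug_surj F (quot_class I f); rewrite augE => /quot_classP Ifu0.
exists (vcomp wphi (sh 0%N) rho u0).
split=> //; first by rewrite addr0; apply: vcompP.
set u := vcomp _ _ _ _ => -[v Hv].
pose z := u - v *m diff F 0.
have Ifu : I (f - \sum_j u 0 j * e j).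
  have := I_homog rho Ifu0; rewrite raddfB /= (wcomp_id Hf).
  rewrite (raddf_sum (wcomp wphi rho)) /=.
  congr (mem_ideal I (_ - _)); apply: eq_bigr => j _.
  by rewrite mulrC (wcompM _ _ (whomog_coarsen phi (He j))) mxE mulrC.
have Iuz : I (\sum_j u 0 j * e j - \sum_j z 0 j * e j).
  rewrite -sumrB; have /exact_aug vd0 : exists v', v *m diff F 0 = v' *m diff F 0.
    by exists v.
  apply/quot_class_eq0; rewrite -[RHS]vd0 augE; congr (quot_class I _).
  apply: eq_bigr => j _; rewrite -mulrBl; congr (_ * _).
  by rewrite /z !mxE opprB addrC subrK.
apply: (nf _ (idealD Ifu Iuz)).
have ->: f - (f - \sum_j u 0 j * e j + (\sum_j u 0 j * e j - \sum_j z 0 j * e j)) =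
  \sum_j z 0 j * e j by ring.
rewrite raddf_sum big1 // => j _ /=.
have := congr1 (fun z : 'rV_ _ => z 0 j) Hv; rewrite mxE [RHS]mxE => zj.
by rewrite rmorphM zj mul0r.
Qed.

Lemma elim_top_cat T T' : uniq (t0 :: T' ++ T) ->
  {in T', forall t, phi (w t) = 1} -> elim_top T 0 -> elim_top (T' ++ T) (size T').
Proof.
elim: T' => [|t T' IHT] //= + HT' topT.
rewrite inE negb_or => /andP[/andP[t0t t0T] /andP[tT uT]].
have HU : uniq (t0 :: T' ++ T) by rewrite /= t0T.
apply: elim_top_cons; rewrite // 1?eq_sym //.
- by apply: HT'; rewrite inE eqxx.
- exact: elim_vanishP.
- by apply: IHT => // s sT'; apply: HT'; rewrite inE sT' orbT.
Qed.

(* Once every variable but the one of index t0 is killed, h kills that one too, and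
   only constant coefficients remain: this is the complex that computes Tor. *)
Section Full.
Variable T : seq 'I_N.
Hypothesis T_full : forall t, t != t0 -> t \in T.

Lemma map_elim_full r (u : 'rV[R]_r) :
  map_mx (psi T) u = 0 <-> map_mx (mcoeff 0%MM) u = 0.
Proof.
split=> u0; apply/rowP => j; have := congr1 (fun z : 'rV_r => z 0 j) u0; rewrite !mxE.
  by rewrite (elim_map_full c _ T_full) => /eqP; rewrite mpolyC_eq0 => /eqP.
by rewrite (elim_map_full c _ T_full) => ->; rewrite mpolyC0.
Qed.

Lemma map_mcoeff0_mul r r' (u : 'rV[R]_r) (d : 'M[R]_(r, r')) :
  map_mx (mcoeff 0%MM) (u *m d) =
  map_mx (mcoeff 0%MM) u *m map_mx (mcoeff 0%MM) d.
Proof. exact: map_mxM. Qed.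

Lemma elim_cycle_full i (u : 'rV[R]_(rank F i)) :
  elim_cycle T u <-> is_cycle (map_mx (mcoeff 0%MM) u).
Proof.
by case: i u => [|i] u //=; rewrite map_elim_full map_mcoeff0_mul.
Qed.

Lemma elim_boundary_full i (u : 'rV[R]_(rank F i)) :
  elim_boundary T u <-> is_boundary (map_mx (mcoeff 0%MM) u).
Proof.
split=> [[v /map_elim_full/eqP]|[v uv]].
  rewrite map_mxB subr_eq0 map_mcoeff0_mul => /eqP ->.
  by exists (map_mx (mcoeff 0%MM) v).
exists (map_mx (@mpolyC N K) v); apply/map_elim_full/eqP.
rewrite map_mxB subr_eq0 map_mcoeff0_mul uv; apply/eqP; congr (_ *m _).
by apply/rowP => j; rewrite !mxE mcoeffC eqxx mulr1.
Qed.

Lemma Tor_le i g (v : 'rV[K]_(rank F i)) : elim_vanish T ->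
  has_degree g v -> is_cycle v -> ~ is_boundary v -> phi g <= rho + i%:Z.
Proof.
move=> VT Hv cv nbv; rewrite leNgt; apply/negP => lt; apply: nbv.
have vK : map_mx (mcoeff 0%MM) (map_mx (@mpolyC N K) v) = v.
  by apply/rowP => j; rewrite !mxE mcoeffC eqxx mulr1.
rewrite -vK; apply/elim_boundary_full; apply: VT lt _ _.
  move=> j; rewrite mxE; have [->|/Hv ->] := eqVneq (v 0 j) 0.
    by rewrite mpolyC0; apply: whomog0.
  by rewrite subrr; apply: whomogC.
by apply/elim_cycle_full; rewrite vK.
Qed.

Definition degree_part i g (v : 'rV[K]_(rank F i)) : 'rV[K]_(rank F i) :=
  \row_j (if shift j == g then v 0 j else 0).

(** The differential preserves [G]-degrees, as a constant coefficient is nonzero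
    only between basis vectors of the same degree. *)
Lemma degree_part_diffK i g (v : 'rV[K]_(rank F i.+1)) :
  degree_part g v *m diffK F i = degree_part g (v *m diffK F i).
Proof.
apply/rowP => b; rewrite !mxE; case: eqP => [<-|ne].
  apply: eq_bigr => j _; rewrite !mxE; case: eqP => // ne.
  rewrite [X in _ = _ * X](_ : _ = 0) ?mulr0 ?mul0r //.
  apply/eqP; rewrite mcoeff_eq0; apply/negP => /(@diff_homog _ _ _ _ _ F i j b).
  by rewrite mnm_wdeg0 => /eqP; rewrite eq_sym subr_eq0 => /eqP.
rewrite big1 // => j _; rewrite !mxE; case: eqP => [ej|]; last by rewrite mul0r.
rewrite [X in _ * X](_ : _ = 0) ?mulr0 //.
apply/eqP; rewrite mcoeff_eq0; apply/negP => /(@diff_homog _ _ _ _ _ F i j b).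
by rewrite mnm_wdeg0 ej => /eqP; rewrite eq_sym subr_eq0 => /eqP /esym.
Qed.

Lemma degree_part_cycle i g (v : 'rV[K]_(rank F i)) :
  is_cycle v -> is_cycle (degree_part g v).
Proof.
case: i v => [|i] v //= cv; rewrite degree_part_diffK cv.
by apply/rowP => b; rewrite !mxE if_same.
Qed.

(** The [phi]-degree of a surviving class is known, but it may mix several
    [G]-degrees: one of its components must survive. *)
Lemma elim_top_Tor i : elim_top T i -> exists (g : G) (v : 'rV[K]_(rank F i)),
  phi g = rho + i%:Z /\ [/\ has_degree g v, is_cycle v & ~ is_boundary v].
Proof.
move=> [u [Hu /elim_cycle_full cu nbu]].
set v := map_mx _ u in cu.
have nbv : ~ is_boundary v by move/elim_boundary_full.
have [g nbg] : exists g, ~ is_boundary (degree_part g v).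
  apply: contrapT => /forallNP allb; apply: nbv.
  have -> : v = \sum_(g <- undup [seq shift j | j <- enum 'I_(rank F i)]) degree_part g v.
    apply/rowP => j; rewrite summxE (bigD1_seq (shift j)) ?undup_uniq //=; last first.
      by rewrite mem_undup map_f // mem_enum.
    rewrite [degree_part _ _ _ _]mxE eqxx big1 ?addr0 // => g /negPf ng.
    by rewrite [LHS]mxE eq_sym ng.
  elim: (undup _) => [|g gs [x IH]].
    by exists 0; rewrite big_nil mul0mx.
  have /contrapT[y Hy] := allb g.
  by exists (y + x); rewrite big_cons mulmxDl -IH -Hy.
exists g, (degree_part g v).
have [j] : exists j, (degree_part g v) 0 j != 0.
  apply: contrapT => /forallNP all0; apply: nbg; exists 0; rewrite mul0mx.
  by apply/rowP => j; rewrite [RHS]mxE; apply: contrapT => /eqP; apply: all0.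
rewrite [degree_part _ _ _ _]mxE; case: ifP => [/eqP sjg vj|]; last by rewrite eqxx.
split.
  rewrite -sjg; move: vj; rewrite mxE -mcoeff_msupp => /(Hu j).
  by rewrite mnm_wdeg0 => /eqP; rewrite eq_sym subr_eq0 => /eqP.
split=> //.
  by move=> j'; rewrite [degree_part _ _ _ _]mxE; case: ifP => [/eqP //|]; rewrite eqxx.
exact: degree_part_cycle.
Qed.

End Full.

End HyperplaneSection.

(** * Finite generation of submodules of free modules *)

(** Dickson's lemma, one coordinate at a time: a finite set that dominates for
    the first [k] coordinates has a largest [k]-th exponent, below which only
    finitely many slices remain to be dominated. *)
Lemma dickson_aux N (k : nat) (A : 'X_{1..N} -> Prop) :
  exists s : seq 'X_{1..N}, (forall x, x \in s -> A x) /\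
    forall x, A x -> exists2 y, y \in s & forall i : 'I_N, (i < k)%N -> (y i <= x i)%N.
Proof.
elim: k A => [|k IHk] A.
  have [[x Ax]|nA] := pselect (exists x, A x).
    exists [:: x]; split=> [y|y _]; first by rewrite inE => /eqP->.
    by exists x; rewrite ?inE.
  by exists [::]; split=> // x Ax; case: nA; exists x.
have [s [sA As]] := IHk A.
have [leNk|ltkN] := leqP N k.
  exists s; split=> // x /As[y ys Hy]; exists y => // i _.
  by apply: Hy; apply: leq_trans leNk.
pose i0 := Ordinal ltkN.
pose B := \max_(x <- s) (x : 'X_{1..N}) i0.
have slices b : exists t : seq 'X_{1..N}, (forall x, x \in t -> A x) /\
    forall x, A x -> (x i0 < b)%N ->
      exists2 y, y \in t & forall i : 'I_N, (i < k.+1)%N -> (y i <= x i)%N.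
  elim: b => [|b [t [tA At]]]; first by exists [::].
  have [t' [t'A At']] := IHk (fun x => A x /\ x i0 = b).
  exists (t ++ t'); split=> [x|x Ax].
    by rewrite mem_cat => /orP[/tA|/t'A[]].
  rewrite ltnS leq_eqVlt => /orP[/eqP xb|/(At x Ax)[y yt Hy]]; last first.
    by exists y; rewrite ?mem_cat ?yt.
  have [//|y yt' Hy] := At' x; exists y; first by rewrite mem_cat yt' orbT.
  move=> i; rewrite ltnS leq_eqVlt => /orP[/eqP ik|/Hy //].
  by have -> : i = i0 by [apply: val_inj]; have [_ ->] := t'A y yt'; rewrite xb.
have [t [tA At]] := slices B.
exists (s ++ t); split=> [x|x Ax]; first by rewrite mem_cat => /orP[/sA|/tA].
have [ltx|leB] := ltnP (x i0) B.
  by have [y yt Hy] := At x Ax ltx; exists y; rewrite ?mem_cat ?yt ?orbT.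
have [y ys Hy] := As x Ax; exists y; first by rewrite mem_cat ys.
move=> i; rewrite ltnS leq_eqVlt => /orP[/eqP ik|/Hy //].
have -> : i = i0 by apply: val_inj.
by apply: leq_trans leB; apply: leq_bigmax_seq.
Qed.

Lemma dickson N (A : 'X_{1..N} -> Prop) :
  exists s : seq 'X_{1..N}, (forall x, x \in s -> A x) /\
    forall x, A x -> exists2 y, y \in s & (y <= x)%MM.
Proof.
have [s [sA As]] := dickson_aux N A; exists s; split=> // x /As[y ys Hy].
by exists y => //; apply/mnm_lepP => i; apply: Hy.
Qed.

(** Hilbert's basis theorem: dividing by elements whose leading monomials dominate
    all leading monomials of the ideal lowers the leading monomial. *)
Lemma ideal_fin_gen (K : fieldType) N (J : ideal {mpoly K[N]}) :
  exists s : seq {mpoly K[N]}, (forall x, x \in s -> J x) /\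
    forall J' : ideal {mpoly K[N]}, (forall x, x \in s -> J' x) ->
      forall p, J p -> J' p.
Proof.
have [s [sA As]] := dickson (fun m => exists p, [/\ J p, p != 0 & mlead p = m]).
have [t [tJ tA]] : exists t : seq {mpoly K[N]},
    (forall x, x \in t -> J x /\ x != 0) /\
    forall m, m \in s -> exists2 x, x \in t & mlead x = m.
  elim: s sA {As} => [|m s IHs] sA; first by exists [::].
  have [t [tJ tA]] := IHs (fun x xs => sA x (@mem_behead _ (m :: s) x xs)).
  have [p [Jp p0 pm]] := sA m (mem_head _ _).
  exists (p :: t); split=> [x|x].
    by rewrite inE => /predU1P[->|/tJ].
  rewrite inE => /predU1P[->|/tA[y yt ym]]; first by exists p; rewrite ?inE ?eqxx.
  by exists y; rewrite ?inE ?yt ?orbT.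
exists t; split=> [x /tJ[]//|J' tJ' p]; elim/mleadrect: p => p IHp Jp.
have [->|p0] := eqVneq p 0; first exact: ideal0.
have [|m ms mp] := As (mlead p); first by exists p.
have [x xt xm] := tA m ms; have [Jx x0] := tJ x xt.
pose a : {mpoly K[N]} := (mleadc p / mleadc x) *: 'X_[mlead p - mlead x].
have J'ax : J' (a * x) by apply/idealMl/tJ'.
have Jq : J (p - a * x).
  by rewrite -mulNr; apply: idealD => //; apply: idealMl.
rewrite -[p](subrK (a * x)); apply: idealD => //.
have [->|q0] := eqVneq (p - a * x) 0; first exact: ideal0.
apply: IHp => //.
have cx0 : mleadc x != 0 by rewrite mleadc_eq0.
have cp0 : mleadc p != 0 by rewrite mleadc_eq0.
have ca0 : mleadc p / mleadc x != 0 by rewrite mulf_neq0 // invr_eq0.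
have aX : mlead a = (mlead p - mlead x)%MM by rewrite mleadZ // mleadXm.
have a0 : a != 0 by rewrite -mleadc_eq0 aX mcoeffZ mcoeffX eqxx mulr1.
have pax : mlead (a * x) = mlead p by rewrite mleadM // aX submK // xm.
rewrite lt_neqAle; apply/andP; split; last first.
  by apply: le_trans (mleadB_le _ _) _; rewrite pax joinxx.
apply: contra_neq q0 => eq_lead; apply/eqP; rewrite -mleadc_eq0 eq_lead.
have cax : (a * x)@_(mlead p) = mleadc p.
  transitivity (mleadc (a * x)); first by rewrite pax.
  by rewrite mleadM // mleadcM aX mcoeffZ mcoeffX eqxx mulr1 divfK.
by rewrite mcoeffB cax subrr.
Qed.

Definition submodule (A : nzRingType) (L : lmodType A) (V : L -> Prop) : Prop :=
  [/\ V 0, forall x y, V x -> V y -> V (x + y) & forall a x, V x -> V (a *: x)].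

(** Stated through all submodules containing the generators, so that coefficients
    need not be handled. *)
Definition generates (A : nzRingType) (L : lmodType A) (s : seq L) (V : L -> Prop) :=
  (forall x, x \in s -> V x) /\
  forall W, submodule W -> (forall x, x \in s -> W x) -> forall x, V x -> W x.

Lemma submoduleB (A : nzRingType) (L : lmodType A) (V : L -> Prop) x y :
  submodule V -> V x -> V y -> V (x - y).
Proof. by case=> _ VD VZ Vx Vy; apply: VD => //; rewrite -scaleN1r; apply: VZ. Qed.

(** By induction on the rank: the first coordinates form an ideal, and the vectors
    with first coordinate 0 a submodule of smaller rank. *)
Lemma submodule_fin_gen (K : fieldType) N r (V : 'rV[{mpoly K[N]}]_r -> Prop) :
  submodule V -> exists s, generates s V.
Proof.
elim: r V => [|r IHr] V HV; have [V0 VD VZ] := HV.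
  exists [::]; split=> // W [W0 _ _] _ x _.
  by rewrite (_ : x = 0) //; apply/rowP; case.
pose hd (x : 'rV[{mpoly K[N]}]_(1 + r)) := lsubmx x 0 0.
have hdD x y : hd (x + y) = hd x + hd y by rewrite /hd !mxE.
have hdZ a x : hd (a *: x) = a * hd x by rewrite /hd !mxE.
have hd_ideal W : submodule W -> exists J : ideal {mpoly K[N]},
    forall a, J a <-> exists2 x, W x & hd x = a.
  move=> [W0 WD WZ].
  have H0 : exists2 x, W x & hd x = 0 by exists 0 => //; rewrite /hd !mxE.
  have HD a b : (exists2 x, W x & hd x = a) -> (exists2 x, W x & hd x = b) ->
      exists2 x, W x & hd x = a + b.
    by move=> [x Wx <-] [y Wy <-]; exists (x + y); [apply: WD | apply: hdD].
  have HM a b : (exists2 x, W x & hd x = b) -> exists2 x, W x & hd x = a * b.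
    by move=> [x Wx <-]; exists (a *: x); [apply: WZ | apply: hdZ].
  by exists (Ideal H0 HD HM).
have [J HJ] := hd_ideal V HV.
have [s [sJ Js]] := ideal_fin_gen J.
have [t [tV tA]] : exists t : seq 'rV[{mpoly K[N]}]_(1 + r),
    (forall x, x \in t -> V x) /\
    forall a, a \in s -> exists2 x, x \in t & hd x = a.
  elim: s sJ {Js} => [|a s IHs] sJ; first by exists [::].
  have [t [tV tA]] := IHs (fun x xs => sJ x (@mem_behead _ (a :: s) x xs)).
  have /HJ[x Vx xa] := sJ a (mem_head _ _).
  exists (x :: t); split=> [y|b].
    by rewrite inE => /predU1P[->|/tV].
  rewrite inE => /predU1P[->|/tA[y yt yb]]; first by exists x; rewrite ?inE ?eqxx.
  by exists y; rewrite ?inE ?yt ?orbT.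
pose tl (y : 'rV[{mpoly K[N]}]_r) : 'rV[{mpoly K[N]}]_(1 + r) := row_mx 0 y.
have tl0 : tl 0 = 0 by rewrite /tl row_mx0.
have tlD x y : tl (x + y) = tl x + tl y by rewrite /tl add_row_mx addr0.
have tlZ a x : tl (a *: x) = a *: tl x by rewrite /tl scale_row_mx scaler0.
have tl_sub W : submodule W -> submodule (W \o tl).
  move=> [W0 WD WZ]; split=> /= [|x y Wx Wy|a x Wx]; first by rewrite tl0.
    by rewrite tlD; apply: WD.
  by rewrite tlZ; apply: WZ.
have [t' [t'V t'A]] := IHr _ (tl_sub V HV).
exists (t ++ [seq tl y | y <- t']); split=> [x|W HW Wt x Vx].
  by rewrite mem_cat => /orP[/tV //|/mapP[y /t'V Vy ->]].
have HWV : submodule (fun x => V x /\ W x).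
  have [W0 WD WZ] := HW; split=> // [y z [Vy Wy] [Vz Wz]|a y [Vy Wy]].
    by split; [apply: VD | apply: WD].
  by split; [apply: VZ | apply: WZ].
have [J' HJ'] := hd_ideal _ HWV.
have /HJ'[y [Vy Wy] yx] : J' (hd x).
  apply: Js => [a /tA[y yt ya]|]; last by apply/HJ; exists x.
  by apply/HJ'; exists y => //; split; [apply: tV | apply: Wt; rewrite mem_cat yt].
pose z : 'rV[{mpoly K[N]}]_(1 + r) := x - y.
have xy : z = tl (rsubmx z).
  rewrite -[LHS]hsubmxK; congr row_mx; apply/rowP => j; rewrite !ord1.
  by move: yx; rewrite /z /hd !mxE => ->; rewrite subrr.
rewrite -[x](subrK y); have [_ WD _] := HW; apply: WD => //; rewrite -/z xy.
apply: (t'A _ (tl_sub W HW)) => [x' xt'|] /=.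
  by apply: Wt; rewrite mem_cat map_f ?orbT.
by rewrite -xy; apply: submoduleB.
Qed.

(** * Graded free resolutions *)

Section Resolution.
Variables (K : fieldType) (N : nat) (G : zmodType) (w : 'I_N -> G).
Local Notation R := {mpoly K[N]}.

Lemma sum_vcomp r (sh : 'I_r -> G) (u : 'rV[R]_r) :
  exists gs : seq G, u = \sum_(g <- gs) vcomp w sh g u.
Proof.
pose gs := undup (flatten [seq [seq g + sh j | g <- wdegs w (u 0 j)] | j <- enum 'I_r]).
exists gs; apply/rowP => j; rewrite summxE.
under eq_bigr do rewrite mxE.
rewrite [LHS](sum_wcomp w).
rewrite -(big_map (fun g => g - sh j) predT (fun g => wcomp w g (u 0 j))).
rewrite [RHS](bigID (mem (wdegs w (u 0 j)))) /= [X in _ = _ + X]big1 ?addr0; last first.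
  move=> g ng; apply/mpolyP => m; rewrite mcoeff_wcomp mcoeff0; case: eqP => // mg.
  apply: memN_msupp_eq0; apply: contra ng => mu.
  by rewrite /wdegs mem_undup -mg map_f.
rewrite -[RHS]big_filter; apply: perm_big; apply: uniq_perm.
- exact: undup_uniq.
- by rewrite filter_uniq // map_inj_uniq ?undup_uniq //; apply: addIr.
move=> g; rewrite mem_filter /=; case: (boolP (g \in wdegs w (u 0 j))) => //= gw.
apply/esym/mapP; exists (g + sh j); last by rewrite addrK.
rewrite mem_undup; apply/flatten_mapP; exists j; first by rewrite mem_enum.
exact: map_f.
Qed.

(** The homogeneous components of finitely many generators are again finitely many
    generators, and they are the rows of a homogeneous matrix. *)
Lemma graded_generators r (sh : 'I_r -> G) (V : 'rV[R]_r -> Prop) :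
  submodule V -> (forall g u, V u -> V (vcomp w sh g u)) ->
  exists (r' : nat) (sh' : 'I_r' -> G) (d : 'M[R]_(r', r)),
    (forall a b, whomog w (sh' a - sh b) (d a b)) /\
    forall u, V u <-> exists v, u = v *m d.
Proof.
move=> HV Vcomp; have [V0 VD VZ] := HV; have [s [sV Vs]] := submodule_fin_gen HV.
have [t [tV ts]] : exists t : seq (G * 'rV[R]_r),
    (forall x, x \in t -> V x.2 /\ vhomog w sh x.1 x.2) /\
    forall W, submodule W -> (forall x, x \in t -> W x.2) ->
      forall u, u \in s -> W u.
  elim: s sV {Vs} => [|u s IHs] sV; first by exists [::].
  have [t [tV ts]] := IHs (fun x xs => sV x (@mem_behead _ (u :: s) x xs)).
  have [gs ugs] := sum_vcomp sh u.
  exists ([seq (g, vcomp w sh g u) | g <- gs] ++ t); split=> [x|W HW Wt].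
    rewrite mem_cat => /orP[/mapP[g _ ->]|/tV //]; split; last exact: vcompP.
    exact/Vcomp/sV/mem_head.
  have [W0 WD _] := HW; move=> x; rewrite inE => /predU1P[->|]; last first.
    by apply: ts => // y yt; apply: Wt; rewrite mem_cat yt orbT.
  rewrite ugs big_seq; elim/big_ind: _ => // g ggs.
  by apply: (Wt (g, vcomp w sh g u)); rewrite mem_cat map_f.
pose x0 : G * 'rV[R]_r := (0, 0).
have tP (a : 'I_(size t)) : nth x0 t a \in t by apply: mem_nth.
exists (size t), (fun a => (nth x0 t a).1), (\matrix_a (nth x0 t a).2).
split=> [a b|u]; first by rewrite mxE; have [_] := tV _ (tP a); apply.
split=> [Vu|[v ->]]; last first.
  rewrite mulmx_sum_row; elim/big_ind: _ => // a _; apply: VZ.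
  by rewrite rowK; have [] := tV _ (tP a).
apply: (Vs (fun u => exists v, u = v *m _)) Vu => [|x xs].
  split=> [|_ _ [v ->] [v' ->]|a _ [v ->]]; first by exists 0; rewrite mul0mx.
    by exists (v + v'); rewrite mulmxDl.
  by exists (a *: v); rewrite scalemxAl.
apply: (ts (fun u => exists v, u = v *m _)) xs => [|y yt].
  split=> [|_ _ [v ->] [v' ->]|a _ [v ->]]; first by exists 0; rewrite mul0mx.
    by exists (v + v'); rewrite mulmxDl.
  by exists (a *: v); rewrite scalemxAl.
have lt_i : (index y t < size t)%N by rewrite index_mem.
by exists (delta_mx 0 (Ordinal lt_i)); rewrite -rowE rowK /= nth_index.
Qed.

(** A graded free module, given by the degrees of its basis. *)
Definition shifts : Type := {r : nat & 'I_r -> G}.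
Definition hom_matrix (A B : shifts) : Type :=
  {d : 'M[R]_(projT1 B, projT1 A) |
     forall a b, whomog w (projT2 B a - projT2 A b) (d a b)}.

Lemma next_syzygies (A B : shifts) (d : hom_matrix A B) :
  {C : shifts & {d' : hom_matrix B C |
    forall u : 'rV[R]_(projT1 B), u *m sval d = 0 <-> exists v, u = v *m sval d'}}.
Proof.
suff ex : exists (C : shifts) (d' : hom_matrix B C),
    forall u : 'rV[R]_(projT1 B), u *m sval d = 0 <-> exists v, u = v *m sval d'.
  by have [C /cid[d' Hd']] := cid ex; exists C, d'.
have [||r [sh [d' [Hd' ker]]]] :=
  @graded_generators _ (projT2 B) (fun u => u *m sval d = 0).
- split=> [|x y x0 y0|a x x0]; first exact: mul0mx.
    by rewrite mulmxDl x0 y0 addr0.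
  by rewrite -scalemxAl x0 scaler0.
- move=> g u u0; rewrite -(vcompM _ _ (svalP d)) u0.
  by apply/rowP => j; rewrite !mxE raddf0.
by exists (existT _ r sh), (exist _ d' Hd').
Qed.

(** A resolution is built by iteration on pairs of consecutive modules with the
    matrix between them, so that the next stage can start from the second module. *)
Definition syzygy_stage : Type := {A : shifts & {B : shifts & hom_matrix A B}}.

Definition next_stage (x : syzygy_stage) : syzygy_stage :=
  let y := next_syzygies (projT2 (projT2 x)) in
  existT _ (projT1 (projT2 x)) (existT _ (projT1 y) (sval (projT2 y))).

Lemma resolution_exists (I : ideal R) :
  (forall g p, I p -> I (wcomp w g p)) -> inhabited (gresolution w (quot_gmodule w I)).
Proof.
move=> Icomp.
have [||r [sh [d [Hd imd]]]] :=
  @graded_generators 1 (fun=> 0) (fun u => I (u 0 0)).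
- split=> [|x y x0 y0|a x x0]; rewrite mxE; [exact: ideal0|exact: idealD|exact: idealMl].
- by move=> g u Iu; rewrite mxE; apply: Icomp.
pose A0 : shifts := existT _ 1%N (fun=> 0).
pose B0 : shifts := existT _ r sh.
pose x0 : syzygy_stage := existT _ A0 (existT _ B0 (exist _ d Hd)).
pose st i := iter i next_stage x0.
have augE (u : 'rV[R]_1) :
    \sum_j u 0 j *: (quot_class I 1 : quot_module I) = quot_class I (u 0 0).
  by rewrite big_ord1; rewrite -[u 0 0 in RHS]mulr1; apply: quot_classZ.
unshelve refine (inhabits (@GResolution K N G w (quot_gmodule w I)
  (fun i => projT1 (projT1 (st i))) (fun i => projT2 (projT1 (st i)))
  (fun=> quot_class I 1)
  (fun i => sval (projT2 (projT2 (st i)))) _ _ _ _ _)).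
- by move=> j; exists 1; split=> //; rewrite -(mpolyC1 N K); apply: whomogC.
- by move=> i a b; apply: (svalP (projT2 (projT2 (st i)))).
- move=> x; exists (const_mx (repr (x : {ideal_quot (ideal_zmod I)}))).
  by rewrite [RHS]augE mxE; apply/esym/quot_class_repr.
- move=> u; rewrite -[X in _ <-> X]imd -quot_class_eq0.
  by rewrite -augE.
- by move=> i u; apply: (svalP (projT2 (next_syzygies (projT2 (projT2 (st i)))))).
Qed.

End Resolution.

(** * Ideals: sums, powers and preimages *)

Section IdealOperations.
Variable A : comNzRingType.
Implicit Types (I J : ideal A) (x y z : A).

Lemma idealB I x y : I x -> I y -> I (x - y).
Proof. by move=> Ix Iy; apply: idealD => //; rewrite -mulN1r; apply: idealMl. Qed.

Lemma ideal_gen_min (S : A -> Prop) J :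
  (forall x, S x -> J x) -> forall x, ideal_gen S x -> J x.
Proof.
move=> SJ _ [c [cS ->]]; rewrite big_seq.
elim/big_ind: _ => [|x y|z /cS Sz]; [exact: ideal0 | exact: idealD |].
exact/idealMl/SJ.
Qed.

Lemma mem_ideal_gen (S : A -> Prop) x : S x -> ideal_gen S x.
Proof.
move=> Sx; exists [:: (1, x)]; split; last by rewrite big_seq1 mul1r.
by move=> z; rewrite inE => /eqP->.
Qed.

Definition ideal_add1 I y : ideal A := ideal_gen (fun x => I x \/ x = y).

Lemma ideal_add1P I y x : ideal_add1 I y x <-> exists q, I (x - y * q).
Proof.
split=> [|[q Iq]]; last first.
  rewrite -(subrK (y * q) x); apply: idealD; first by apply: mem_ideal_gen; left.
  by rewrite mulrC; apply: idealMl; apply: mem_ideal_gen; right.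
have H0 : exists q, I (0 - y * q) by exists 0; rewrite mulr0 subr0; apply: ideal0.
have HD x1 x2 : (exists q, I (x1 - y * q)) -> (exists q, I (x2 - y * q)) ->
    exists q, I (x1 + x2 - y * q).
  move=> [q1 H1] [q2 H2]; exists (q1 + q2).
  by rewrite mulrDr opprD addrACA; apply: idealD.
have HM a x1 : (exists q, I (x1 - y * q)) -> exists q, I (a * x1 - y * q).
  by move=> [q Iq]; exists (a * q); rewrite mulrCA -mulrBr; apply: idealMl.
apply: (@ideal_gen_min _ (Ideal H0 HD HM)) => {x}x [Ix|->] /=.
  by exists 0; rewrite mulr0 subr0.
by exists 1; rewrite mulr1 subrr; apply: ideal0.
Qed.

Lemma ideal_capP (T : Type) (J : T -> ideal A) x : ideal_cap J x <-> forall t, J t x.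
Proof. by []. Qed.

Definition ideal_colon I z : ideal A.
Proof.
refine (@Ideal A (fun x => I (x * z)) _ _ _).
- by rewrite mul0r; apply: ideal0.
- by move=> x y; rewrite mulrDl; apply: idealD.
- by move=> a x; rewrite -mulrA; apply: idealMl.
Defined.

Lemma ideal_colonE I z x : ideal_colon I z x = I (x * z). Proof. by []. Qed.

Lemma ideal_exp0 I x : ideal_exp I 0 x.
Proof.
rewrite -[x]mulr1; apply: idealMl; apply: mem_ideal_gen; exists (fun=> 0).
by split; [case | rewrite big_ord0].
Qed.

Lemma ideal_exp1 I x : I x -> ideal_exp I 1 x.
Proof.
by move=> Ix; apply: mem_ideal_gen; exists (fun=> x); split; rewrite ?big_ord1.
Qed.

Lemma ideal_expM I a b x y :
  ideal_exp I a x -> ideal_exp I b y -> ideal_exp I (a + b) (x * y).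
Proof.
move=> Ix Iy.
apply: (@ideal_gen_min _ (ideal_colon (ideal_exp I (a + b)) y)) Ix.
move=> _ [g [Ig ->]]; rewrite ideal_colonE mulrC -ideal_colonE.
apply: (@ideal_gen_min _ (ideal_colon (ideal_exp I (a + b)) (\prod_t g t))) Iy.
move=> _ [g' [Ig' ->]]; rewrite ideal_colonE; apply: mem_ideal_gen.
exists (fun t => match split t with inl t1 => g t1 | inr t2 => g' t2 end).
split=> [t|]; first by case: split => t'; [apply: Ig | apply: Ig'].
rewrite mulrC big_split_ord; congr (_ * _); apply: eq_bigr => t _.
  by rewrite (unsplitK (inl t)).
by rewrite (unsplitK (inr t)).
Qed.

Lemma ideal_exp_le I a b x : (a <= b)%N -> ideal_exp I b x -> ideal_exp I a x.
Proof.
move=> /subnKC <-; apply: ideal_gen_min => _ [g [Ig ->]].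
rewrite big_split_ord /= mulrC.
apply: (@idealMl _ (ideal_exp I a)); apply: mem_ideal_gen.
by exists (fun t => g (lshift _ t)).
Qed.

End IdealOperations.

Definition ideal_preim (A B : comNzRingType) (f : {rmorphism A -> B}) (J : ideal B) :
  ideal A.
Proof.
refine (@Ideal A (fun x => J (f x)) _ _ _).
- by rewrite rmorph0; apply: ideal0.
- by move=> x y; rewrite rmorphD; apply: idealD.
- by move=> a x; rewrite rmorphM; apply: idealMl.
Defined.

Lemma principal_preim (A B : comNzRingType) (f : {rmorphism A -> B}) x y :
  principal x y -> principal (f x) (f y).
Proof. by move=> /principalP[q ->]; apply/principalP; exists (f q); rewrite rmorphM. Qed.

Lemma elim_map_ideal (K : fieldType) N (c : 'I_N -> K) t0 (T : seq 'I_N)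
    (Q : ideal {mpoly K[N]}) f :
  c t0 = 1 -> Q (linform c) -> (forall t, t \in T -> Q 'X_t) ->
  elim_map c t0 T f = 0 -> Q f.
Proof.
move=> c_t0 Qh QT f0; rewrite -[f]subr0 -f0.
apply: (rmorph_mpoly_congr (f := idfun) (g := elim_map c t0 T)) => [a|t].
  by rewrite elim_mapC.
rewrite elim_mapX /elim_var /=; case: eqP => [->|_]; last first.
  by case: ifP => [/QT Qt|_]; rewrite ?subr0 // subrr; apply: ideal0.
rewrite opprK.
have -> : 'X_t0 + \sum_(s | (s != t0) && (s \notin T)) c s *: 'X_s =
    linform c - \sum_(s | (s != t0) && (s \in T)) c s *: 'X_s.
  rewrite /linform [X in _ = X - _](bigD1 t0) //= c_t0 scale1r -addrA; congr (_ + _).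
  rewrite [X in _ = X - _](bigID (mem T)) /= [X in _ = X - _]addrC addrK.
  by [].
apply: idealB => //; elim/big_ind: _ => [|x y|s /andP[_ /QT Qs]].
- exact: ideal0.
- exact: idealD.
- by rewrite -mul_mpolyC; apply: idealMl.
Qed.

(** A component for the coarser grading is a sum of components for the finer one. *)
Lemma wcomp_coarsen (K : fieldType) N (G : zmodType) (w : 'I_N -> G)
    (phi : {additive G -> int}) (I : ideal {mpoly K[N]}) :
  (forall g p, I p -> I (wcomp w g p)) ->
  forall a p, I p -> I (wcomp (phi \o w) a p).
Proof.
move=> Iw a p Ip; rewrite [p](sum_wcomp w) (raddf_sum (wcomp _ a)) /=.
elim/big_ind: _ => [|x y|g _]; [exact: ideal0 | exact: idealD |].
rewrite (wcomp_homog _ (whomog_coarsen phi (wcompP w g p))).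
by case: eqP => _; [apply: Iw | apply: ideal0].
Qed.

(** The regularity is read off the hyperplane section: [rho] is the top degree of
    the quotient by I + (h). The ideal [Q] certifies that a form of degree
    [rho] survives even after all variables of weight 0 are killed. *)
Lemma Tor_maximum (K : fieldType) N (G : zmodType) (w : 'I_N -> G)
    (phi : {additive G -> int}) (c : 'I_N -> K) (t0 : 'I_N) (rho : int)
    (I Q : ideal {mpoly K[N]}) (f : {mpoly K[N]}) :
  c t0 = 1 -> (forall t, c t != 0 -> phi (w t) = 1) ->
  (forall t, phi (w t) = 0 \/ phi (w t) = 1) ->
  (forall g p, I p -> I (wcomp w g p)) ->
  (forall p, I (linform c * p) -> I p) ->
  (forall (a : int) p, rho < a -> whomog (phi \o w) a p -> ideal_add1 I (linform c) p) ->
  (forall p, I p -> Q p) -> Q (linform c) ->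
  (forall t, phi (w t) = 0 -> Q 'X_t) ->
  whomog (phi \o w) rho f -> ~ Q f ->
  is_maximum (fun a => exists (i : nat) (g : G),
    phi g = a + i%:Z /\ Tor_neq0 w (quot_gmodule w I) i g) rho.
Proof.
move=> c_t0 c_deg1 deg01 Iw hreg top IQ Qh QX Hf nQf.
have top' (a : int) p : rho < a -> whomog (phi \o w) a p -> exists q, I (p - linform c * q).
  by move=> lt Hp; apply/ideal_add1P/top/Hp.
pose T1 := [seq t <- enum 'I_N | (phi (w t) == 1) && (t != t0)].
pose T0 := [seq t <- enum 'I_N | phi (w t) == 0].
have w_t0 : phi (w t0) = 1 by apply: c_deg1; rewrite c_t0 oner_eq0.
have uT : uniq (t0 :: T1 ++ T0).
  rewrite /= mem_cat !mem_filter w_t0 !eqxx /= cat_uniq.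
  have uE := enum_uniq 'I_N; apply/and3P; split; [exact: filter_uniq| |exact: filter_uniq].
  rewrite -all_predC; apply/allP => t; rewrite mem_filter => /andP[/eqP wt _].
  by rewrite /= mem_filter wt.
have T_full t : t != t0 -> t \in T1 ++ T0.
  move=> tt0; rewrite mem_cat [_ \in T1]mem_filter [_ \in T0]mem_filter mem_enum tt0.
  by case: (deg01 t) => ->.
split=> [|a [i [g [ga [F [v [Hv cv nbv]]]]]]]; last first.
  have := Tor_le T_full (elim_vanishP c_t0 c_deg1 deg01 hreg top' uT) Hv cv nbv.
  by rewrite ga lerD2r.
have [F] := resolution_exists Iw.
have : elim_top phi c t0 F rho T0 0.
  apply: (elim_top0 F _ Hf) => [a p|p Ip p0].
    exact: wcomp_coarsen.
  apply: nQf; rewrite -(subrK p f); apply: idealD; last exact: IQ.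
  apply: elim_map_ideal p0 => // t; rewrite mem_filter => /andP[/eqP wt _].
  exact: QX.
move=> /(elim_top_cat c_t0 c_deg1 deg01 hreg top' uT) topT.
have [|g [v [gv Hv]]] := elim_top_Tor T_full (topT _).
  by move=> t; rewrite mem_filter => /andP[/andP[/eqP]].
by exists (size T1), g; split=> //; exists F, v.
Qed.

(** * Powers of the ideal of a point *)

Lemma principal_XnP (A : comNzRingType) (d : nat) (p : {poly A}) :
  principal ('X^d) p <-> forall e, (e < d)%N -> p`_e = 0.
Proof.
split=> [/principalP[q ->] e lt|p0]; first by rewrite coefXnM lt.
apply/principalP; exists (drop_poly d p); rewrite -{1}(poly_take_drop d p) mulrC.
rewrite [take_poly d p](_ : _ = 0) ?add0r //; apply/polyP => e.
by rewrite coef_take_poly coef0; case: ltnP => // /p0.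
Qed.

(** The lowest nonzero coefficient of [q] times the constant coefficient of [p] is a
    coefficient of the product. *)
Lemma principal_Xn_cancel (A : idomainType) (d : nat) (p q : {poly A}) :
  p`_0 != 0 -> principal ('X^d) (p * q) -> principal ('X^d) q.
Proof.
move=> p0 /principal_XnP pq0; apply/principal_XnP => e.
elim/ltn_ind: e => e IHe lted.
have := pq0 e lted; rewrite coefM (bigD1 ord0) //= subn0 big1 ?addr0.
  by move=> /eqP; rewrite mulf_eq0 (negPf p0) => /eqP.
move=> i; rewrite -val_eqE /= -lt0n => i0.
have ile := ltn_ord i; rewrite ltnS in ile.
by rewrite (IHe (e - i)%N) ?mulr0 //; lia.
Qed.

Section ConePoint.
Variables (K : fieldType) (N : nat) (G : zmodType) (w : 'I_N -> G).
Variable (C : ('I_N -> K) -> Prop).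
(* [v] is a representative of the point and [C] the cone of all its
   representatives; [o t] is a variable of the block of [t] in which [v] is 1. *)
Variables (o : 'I_N -> 'I_N) (v : 'I_N -> K).
Local Notation R := {mpoly K[N]}.
Local Notation IP := (forms_ideal w C).
Hypothesis C_v : C v.
Hypothesis C_prop : forall x, C x -> forall t, x t = v t * x (o t).
Hypothesis w_o : forall t, w (o t) = w t.
(* The grading determines the degree in each block. *)
Hypothesis block_deg : forall m m' : 'X_{1..N}, mnm_wdeg w m = mnm_wdeg w m' ->
  \prod_t ('X_(o t) : R) ^+ m t = \prod_t 'X_(o t) ^+ m' t.

Definition cone_form (t : 'I_N) : R := 'X_t - v t *: 'X_(o t).

(** The expansion of [f] along the line from the point: the coefficient of the
    [d]-th power of the new variable is the part of degree [d] in the linear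
    forms that cut out the point. *)
Definition expansion : {rmorphism R -> {poly R}} :=
  mpoly_hom (@polyC R \o @mpolyC N K)
    (fun t => (v t *: 'X_(o t))%:P + 'X * (cone_form t)%:P).

Lemma expansionC a : expansion a%:MP = (a%:MP)%:P.
Proof. exact: mpoly_homC. Qed.

Lemma expansionX t : expansion 'X_t = (v t *: 'X_(o t))%:P + 'X * (cone_form t)%:P.
Proof. exact: mpoly_homX. Qed.

Lemma cone_formP t : IP (cone_form t).
Proof.
apply: mem_ideal_gen; split=> [|x Cx].
  exists (w t); apply: whomogD; first exact: whomogU.
  by apply/whomogN/whomogZ; rewrite -(w_o t); apply: whomogU.
by rewrite mevalB mevalZ !mevalXU -C_prop // subrr.
Qed.

Lemma expansion_1 f : (expansion f).[1] = f.
Proof.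
apply: (rmorph_mpoly_eq (f := horner_eval (1 : R) \o expansion) (g := idfun)).
  by move=> a /=; rewrite expansionC /horner_eval hornerC.
move=> t /=; rewrite expansionX /horner_eval hornerD hornerM hornerX !hornerC.
by rewrite mul1r /cone_form addrC subrK.
Qed.

Lemma coef_expansion f d : ideal_exp IP d (expansion f)`_d.
Proof.
elim/mpoly_gen_ind: f d => [a|t|p q Hp Hq|p q Hp Hq] d.
- rewrite expansionC coefC; case: eqP => [->|_]; last exact: ideal0.
  exact: ideal_exp0.
- rewrite expansionX coefD coefC coefXM coefC; case: d => [|[|d]].
  + exact: ideal_exp0.
  + by rewrite add0r; apply/ideal_exp1/cone_formP.
  + by rewrite addr0; apply: (ideal0 (ideal_exp IP _)).
- by rewrite rmorphD coefD; apply: idealD.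
rewrite rmorphM coefM; elim/big_ind: _ => [|x y|i _]; [exact: ideal0|exact: idealD|].
rewrite -[X in ideal_exp _ X](@subnKC i d) ?leq_ord //.
exact: ideal_expM.
Qed.

(** The constant coefficient is the value of [f] on the cone over the point; for a
    homogeneous [f] it is the value at [v] times a monomial. *)
Lemma coef0_expansion f : IP f -> (expansion f)`_0 = 0.
Proof.
pose ev0 : {rmorphism R -> R} := horner_eval (0 : R) \o expansion.
have ev0E p : ev0 p = (expansion p)`_0 by rewrite /ev0 /= /horner_eval horner_coef0.
suff sub : forall p, IP p -> ideal_preim ev0 (principal 0) p.
  move=> /sub; rewrite -ev0E => H; have /principalP[q] : principal 0 (ev0 f) by [].
  by rewrite mul0r.
apply: ideal_gen_min => {}f [[g Hg] /(_ v C_v) fv0].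
apply/principalP; exists 0; rewrite mulr0.
have ev0X t : ev0 'X_t = v t *: 'X_(o t).
  by rewrite ev0E expansionX coefD coefC coefXM addr0.
have ev0C a : ev0 a%:MP = a%:MP by rewrite ev0E expansionC coefC.
have ev0XX m : ev0 'X_[m] = (\prod_t v t ^+ m t) *: \prod_t 'X_(o t) ^+ m t.
  rewrite mpolyXE_id rmorph_prod -scaler_prod; apply: eq_bigr => t _.
  by rewrite rmorphXn ev0X exprZn.
have [-> |/mlead_supp lf] := eqVneq f 0; first exact: rmorph0.
rewrite [f in LHS]mpolyE rmorph_sum big_seq.
rewrite (eq_bigr (fun m => (f@_m * \prod_t v t ^+ m t) *:
    \prod_t ('X_(o t) : R) ^+ mlead f t)); last first.
  move=> m mf; rewrite -mul_mpolyC rmorphM ev0C ev0XX mul_mpolyC scalerA.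
  by rewrite (block_deg (m' := mlead f)) // !Hg.
by rewrite -scaler_suml -big_seq -mevalE fv0 scale0r.
Qed.

(** Elements of the ideal have expansions divisible by the new variable, and
    conversely [f] is the sum of the coefficients of its expansion, the [e]-th of
    which lies in the [e]-th power of the ideal. *)
Lemma ideal_exp_expansion d f :
  ideal_exp IP d f <-> principal ('X^d) (expansion f).
Proof.
split.
  apply: (@ideal_gen_min _ _ (ideal_preim expansion (principal ('X^d)))).
  move=> _ [g [Ig ->]] /=.
  suff : principal ('X^d) (expansion (\prod_t g t)) by [].
  rewrite rmorph_prod; elim: d g Ig => [|d IHd] g Ig.
    by apply/principalP; rewrite expr0; exists 1; rewrite big_ord0 mulr1.
  rewrite big_ord_recl.
  have /principalP[q ->] := IHd (fun t => g (lift ord0 t)) (fun t => Ig _).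
  have /principalP[q' ->] : principal ('X^1) (expansion (g ord0)).
    by apply/principal_XnP => -[|//] _; apply: coef0_expansion.
  by apply/principalP; exists (q' * q); rewrite expr1 exprS mulrACA.
move=> /principal_XnP f0; rewrite -(expansion_1 f) horner_coef.
elim/big_ind: _ => [|x y|e _]; [exact: ideal0 | exact: idealD |].
rewrite expr1n mulr1; have [/f0 ->|led] := ltnP e d; first exact: ideal0.
exact: ideal_exp_le led (coef_expansion f e).
Qed.

(** The constant coefficient of the expansion of [h] is [h] on the cone over the
    point, so this says that powers of the ideal of a point are primary. *)
Lemma ideal_exp_primary d h f :
  (expansion h)`_0 != 0 -> ideal_exp IP d (h * f) -> ideal_exp IP d f.
Proof.
move=> h0 /ideal_exp_expansion; rewrite rmorphM => hf.
by apply/ideal_exp_expansion; apply: principal_Xn_cancel hf.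
Qed.

Lemma expansion_wcomp g f e :
  (expansion (wcomp w g f))`_e = wcomp w g (expansion f)`_e.
Proof.
have homogE : forall a p, whomog w a p -> forall d, whomog w a (expansion p)`_d.
  apply: (rmorph_graded (Q := fun a (x : {poly R}) => forall d, whomog w a x`_d))
    => [a d|a x y Hx Hy d|a b x y Hx Hy d|a d|t d].
  - by rewrite coef0; apply: whomog0.
  - by rewrite coefD; apply: whomogD.
  - by rewrite coefM; apply: whomog_sum => i _; apply: whomogM.
  - rewrite expansionC coefC; case: eqP => _; [exact: whomogC | exact: whomog0].
  have Xo : whomog w (w t) ('X_(o t) : R) by rewrite -w_o; apply: whomogU.
  rewrite expansionX coefD coefC coefXM coefC; case: d => [|[|d]].
  - by rewrite addr0; apply: whomogZ.
  - by rewrite add0r; apply: whomogD; [apply: whomogU | apply/whomogN/whomogZ].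
  - by rewrite addr0; apply: whomog0.
rewrite [f in RHS](sum_wcomp w) [f in LHS](sum_wcomp w).
rewrite (raddf_sum (wcomp w g)) !(rmorph_sum expansion) !coef_sum (raddf_sum (wcomp w g)).
apply: eq_bigr => b _ /=.
rewrite (wcomp_homog _ (homogE _ _ (wcompP w b f) e)) (wcomp_homog _ (wcompP w b f)).
by case: eqP => _; rewrite ?rmorph0 ?coef0.
Qed.

Lemma ideal_exp_wcomp d g f : ideal_exp IP d f -> ideal_exp IP d (wcomp w g f).
Proof.
move=> /ideal_exp_expansion/principal_XnP f0.
apply/ideal_exp_expansion/principal_XnP => e lt.
by rewrite expansion_wcomp f0 ?raddf0.
Qed.

Lemma mcoeff0_expansion f : ((expansion f)`_0)@_0%MM = f@_0%MM.
Proof.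
rewrite -horner_coef0.
apply: (rmorph_mpoly_eq (f := mcoeff 0%MM \o horner_eval (0 : R) \o expansion)
  (g := mcoeff 0%MM)) => [a|t] /=.
  by rewrite expansionC /horner_eval hornerC.
rewrite expansionX /horner_eval hornerD hornerM hornerX !hornerC mul0r addr0.
by rewrite mcoeffZ !mcoeffX !mnm1_eq0 mulr0.
Qed.

Lemma ideal_exp_mcoeff0 d f : (0 < d)%N -> ideal_exp IP d f -> f@_0%MM = 0.
Proof.
move=> d0 /ideal_exp_expansion/principal_XnP f0.
by rewrite -mcoeff0_expansion f0 ?mcoeff0.
Qed.

End ConePoint.

(** * Comparing a factor with the product *)

Section Transfer.
Variables (K : fieldType) (M N : nat) (alpha : 'I_M -> 'I_N).
Hypothesis alpha_inj : injective alpha.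
Local Notation S := {mpoly K[M]}.
Local Notation R := {mpoly K[N]}.

Definition incl_hom : {rmorphism S -> R} := mpoly_hom (@mpolyC N K) (fun x => 'X_(alpha x)).

(** The sum has at most one term, so this is the retraction of [incl_hom] that kills
    the variables outside the image. *)
Definition retr_hom : {rmorphism R -> S} :=
  mpoly_hom (@mpolyC M K) (fun t => \sum_(x | alpha x == t) 'X_x).

Lemma incl_homC a : incl_hom a%:MP = a%:MP. Proof. exact: mpoly_homC. Qed.
Lemma incl_homX x : incl_hom 'X_x = 'X_(alpha x). Proof. exact: mpoly_homX. Qed.
Lemma incl_homZ a p : incl_hom (a *: p) = a *: incl_hom p.
Proof. by rewrite -!mul_mpolyC rmorphM incl_homC. Qed.
Lemma retr_homC a : retr_hom a%:MP = a%:MP. Proof. exact: mpoly_homC. Qed.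
Lemma retr_homZ a p : retr_hom (a *: p) = a *: retr_hom p.
Proof. by rewrite -!mul_mpolyC rmorphM retr_homC. Qed.

Lemma retr_homX x : retr_hom 'X_(alpha x) = 'X_x.
Proof.
rewrite [LHS]mpoly_homX (big_pred1 x) // => y.
by rewrite /= (inj_eq alpha_inj).
Qed.

Lemma retr_homX0 t : (forall x, alpha x != t) -> retr_hom 'X_t = 0.
Proof. by move=> Ht; rewrite [LHS]mpoly_homX big1 // => x; rewrite (negPf (Ht x)). Qed.

Lemma incl_homK f : retr_hom (incl_hom f) = f.
Proof.
apply: (rmorph_mpoly_eq (f := retr_hom \o incl_hom) (g := idfun)) => [a|x] /=.
  by rewrite incl_homC retr_homC.
by rewrite incl_homX retr_homX.
Qed.

Definition extend_coef (c : 'I_M -> K) (t : 'I_N) : K := \sum_(x | alpha x == t) c x.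

Lemma extend_coefE c x : extend_coef c (alpha x) = c x.
Proof.
rewrite /extend_coef (big_pred1 x) // => y.
by rewrite /= (inj_eq alpha_inj).
Qed.

Lemma extend_coef_neq0 c t : extend_coef c t != 0 -> exists x, alpha x = t.
Proof.
move=> ct; have [x /eqP xt|nx] := pickP (fun x => alpha x == t); first by exists x.
by move: ct; rewrite /extend_coef big_pred0 ?eqxx.
Qed.

Lemma incl_linform c : incl_hom (linform c) = linform (extend_coef c).
Proof.
rewrite /linform rmorph_sum /=.
under [RHS]eq_bigr do rewrite scaler_suml.
rewrite [RHS](exchange_big_dep predT) //=; apply: eq_bigr => x _.
rewrite (big_pred1 (alpha x)) => [|t]; first by rewrite incl_homZ incl_homX.
by rewrite /= eq_sym.
Qed.

Variables (o' : 'I_M -> 'I_M) (v' : 'I_M -> K) (o : 'I_N -> 'I_N) (v : 'I_N -> K).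
Hypothesis o_alpha : forall x, o (alpha x) = alpha (o' x).
Hypothesis v_alpha : forall x, v (alpha x) = v' x.
Hypothesis o_out : forall t, (forall x, alpha x != t) -> forall x, alpha x != o t.

Lemma expansion_incl f :
  expansion o v (incl_hom f) = map_poly incl_hom (expansion o' v' f).
Proof.
apply: (rmorph_mpoly_eq (f := expansion o v \o incl_hom)
  (g := map_poly incl_hom \o expansion o' v')) => [a|x] /=.
  by rewrite incl_homC !expansionC map_polyC /= incl_homC.
rewrite incl_homX !expansionX (rmorphD (map_poly incl_hom)) (rmorphM (map_poly incl_hom)).
rewrite /= map_polyX !map_polyC /=.
by rewrite (rmorphB incl_hom) !incl_homZ !incl_homX /cone_form o_alpha v_alpha.
Qed.

(** The retraction respects expansions because the blocks outside the image are
    killed as a whole. *)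
Lemma expansion_retr f :
  expansion o' v' (retr_hom f) = map_poly retr_hom (expansion o v f).
Proof.
apply: (rmorph_mpoly_eq (f := expansion o' v' \o retr_hom)
  (g := map_poly retr_hom \o expansion o v)) => [a|t] /=.
  by rewrite retr_homC !expansionC map_polyC /= retr_homC.
rewrite expansionX (rmorphD (map_poly retr_hom)) (rmorphM (map_poly retr_hom)).
rewrite /= map_polyX !map_polyC /= (rmorphB retr_hom) !retr_homZ.
have [x /eqP <-|nt] := pickP (fun x => alpha x == t).
  by rewrite o_alpha v_alpha !retr_homX expansionX.
have Ht x : alpha x != t by rewrite nt.
by rewrite !retr_homX0 //; [rewrite !scaler0 subrr polyC0 mulr0 addr0 rmorph0 | apply: o_out].
Qed.

End Transfer.

(** * Points of projective space *)

Lemma closed_field_nonroot (K : closedFieldType) (p : {poly K}) :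
  [pchar K] =i pred0 -> p != 0 -> exists x, p.[x] != 0.
Proof.
move=> charK p0; pose s := [seq i%:R : K | i <- iota 0 (size p)].
have us : uniq s.
  rewrite map_inj_uniq ?iota_uniq // => i j /eqP.
  wlog le_ij : i j / (i <= j)%N.
    by move=> H; case/orP: (leq_total i j) => /H // H'; rewrite eq_sym => /H'.
  rewrite eq_sym -subr_eq0 -natrB // ((pcharf0P K).1 charK) subn_eq0 => le_ji.
  by apply/eqP; rewrite eqn_leq le_ij.
have /allPn[x _ /= nx] : ~~ all (root p) s.
  apply/negP => all_s; have := max_poly_roots p0 all_s us.
  by rewrite size_map size_iota ltnn.
by exists x.
Qed.

(** The coefficients are the powers of a scalar that avoids the roots of finitely
    many polynomials. *)
Lemma general_linear_form (K : closedFieldType) (n s : nat) (u : 'I_s -> 'rV[K]_n.+1) :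
  [pchar K] =i pred0 -> (forall j, u j != 0) ->
  exists c : 'I_n.+1 -> K, c ord0 = 1 /\ forall j, \sum_t c t * u j 0 t != 0.
Proof.
move=> charK u0; pose p j : {poly K} := \poly_(i < n.+1) u j 0 (inord i).
have p0 : \prod_j p j != 0.
  apply/prodf_neq0 => j _; apply: contra (u0 j) => /eqP pj; apply/eqP/rowP => t.
  have := congr1 (fun q : {poly K} => q`_t) pj.
  by rewrite coef_poly ltn_ord inord_val coef0 mxE.
have [x px] := closed_field_nonroot charK p0.
exists (fun t => x ^+ t); split=> // j; move: px.
rewrite horner_prod => /prodf_neq0/(_ j isT); rewrite horner_poly.
by under eq_bigr do rewrite inord_val mulrC.
Qed.

Section ProjectivePoint.
Variables (K : fieldType) (n : nat).

(** A representative normalised to be 1 at some coordinate: at that coordinate any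
    other representative shows the factor by which it differs. *)
Lemma proj_repr_exists (P : proj K n) : exists z : 'I_n.+1 * 'rV[K]_n.+1,
  represents z.2 P /\
  forall u, represents u P -> forall t, u 0 t = z.2 0 t * u 0 z.1.
Proof.
case: P => L dimL /=.
have L0 : L != 0%VS by rewrite -dimv_eq0 (eqP dimL).
pose u := vpick L; have uL : u \in L := memv_pick L.
have u0 : u != 0 by rewrite vpick0.
have [t ut] : exists t, u 0 t != 0.
  by have /rV0Pn[t ut] := u0; exists t.
have Lu : L = <[u]>%VS.
  by apply/esym/eqP; rewrite eqEdim -memvE uL dim_vline u0 (eqP dimL).
exists (t, (u 0 t)^-1 *: u); split=> /=.
  by split; rewrite /= ?memvZ // scaler_eq0 invr_eq0 (negPf ut).
move=> z [/= zL _] i; move: zL; rewrite Lu => /vlineP[a ->].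
by rewrite !mxE; field.
Qed.

Definition proj_base (P : proj K n) : 'I_n.+1 := (sval (cid (proj_repr_exists P))).1.
Definition proj_vec (P : proj K n) : 'rV[K]_n.+1 := (sval (cid (proj_repr_exists P))).2.

Lemma proj_vecP P : represents (proj_vec P) P.
Proof. by case: (svalP (cid (proj_repr_exists P))). Qed.

Lemma represents_prop P u t :
  represents u P -> u 0 t = proj_vec P 0 t * u 0 (proj_base P).
Proof. by case: (svalP (cid (proj_repr_exists P))) => _ H /H. Qed.

Lemma std_wdeg (m : 'X_{1..n.+1}) : mnm_wdeg (@std_weight n.+1) m = (mdeg m)%:Z.
Proof.
rewrite /mnm_wdeg mdegE -natz natr_sum.
by [].
Qed.

End ProjectivePoint.

(** * Fat points in one projective space *)

Section FatPoints.
Variables (K : fieldType) (n : nat).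
Local Notation S := {mpoly K[n.+1]}.
Local Notation std := (@std_weight n.+1).

Definition pt_base (P : proj K n) : 'I_n.+1 -> 'I_n.+1 := fun=> proj_base P.
Definition pt_coord (P : proj K n) : 'I_n.+1 -> K := fun t => proj_vec P 0 t.
Local Notation pt_expansion P := (expansion (pt_base P) (pt_coord P)).
Local Notation cone P := (fun x : 'I_n.+1 -> K =>
  exists v, represents v P /\ forall t, x t = v 0 t).

Lemma pt_cone P : cone P (pt_coord P).
Proof. by exists (proj_vec P); split=> //; apply: proj_vecP. Qed.

Lemma pt_cone_prop P x : cone P x -> forall t, x t = pt_coord P t * x (pt_base P t).
Proof. by move=> [u [Pu xu]] t; rewrite !xu (represents_prop _ Pu). Qed.

Lemma pt_weight P t : std (pt_base P t) = std t. Proof. by []. Qed.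

Lemma pt_block_deg P (m m' : 'X_{1..n.+1}) : mnm_wdeg std m = mnm_wdeg std m' ->
  \prod_t ('X_(pt_base P t) : S) ^+ m t = \prod_t 'X_(pt_base P t) ^+ m' t.
Proof. by rewrite !std_wdeg /pt_base !prodrXr -!mdegE => -[->]. Qed.

Lemma proj_ideal_exp P d (f : S) :
  ideal_exp (proj_ideal P) d f <-> principal ('X^d) (pt_expansion P f).
Proof.
exact: (ideal_exp_expansion (pt_cone P) (@pt_cone_prop P) (pt_weight P)
  (@pt_block_deg P)).
Qed.

Lemma proj_ideal_wcomp P d g (f : S) :
  ideal_exp (proj_ideal P) d f -> ideal_exp (proj_ideal P) d (wcomp std g f).
Proof.
exact: (ideal_exp_wcomp (pt_cone P) (@pt_cone_prop P) (pt_weight P)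
  (@pt_block_deg P)).
Qed.

Lemma expansion_linform P (c : 'I_n.+1 -> K) : (pt_expansion P (linform c))`_0 =
  (\sum_t c t * proj_vec P 0 t) *: 'X_(proj_base P).
Proof.
rewrite rmorph_sum coef_sum scaler_suml; apply: eq_bigr => t _.
rewrite -mul_mpolyC rmorphM expansionC /= expansionX coefCM coefD coefC coefXM addr0.
by rewrite mul_mpolyC scalerA.
Qed.

Lemma expansion_linform_neq0 P (c : 'I_n.+1 -> K) :
  \sum_t c t * proj_vec P 0 t != 0 -> (pt_expansion P (linform c))`_0 != 0.
Proof.
rewrite expansion_linform => a0; apply/eqP => /(congr1 (mcoeff U_(proj_base P)%MM)) /eqP.
by rewrite mcoeffZ mcoeffX eqxx mulr1 mcoeff0 (negPf a0).
Qed.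

(** A hyperplane missing the point meets its affine cone only in the origin. *)
Lemma mem_proj_ideal_add1 P (c : 'I_n.+1 -> K) t :
  \sum_t c t * proj_vec P 0 t != 0 -> ideal_add1 (proj_ideal P) (linform c) 'X_t.
Proof.
set a := \sum_t _ => a0; set Q := ideal_add1 _ _.
have Qy t' : Q (cone_form (pt_base P) (pt_coord P) t').
  by apply: mem_ideal_gen; left; apply: (cone_formP (@pt_cone_prop P)).
have Qh : Q (linform c) by apply: mem_ideal_gen; right.
have Qb : Q 'X_(proj_base P).
  have -> : 'X_(proj_base P) = (a^-1)%:MP *
      (linform c - \sum_t' (c t')%:MP * cone_form (pt_base P) (pt_coord P) t').
    rewrite /linform -sumrB.
    under eq_bigr => t' _ do
      rewrite /cone_form /pt_base /pt_coord mul_mpolyC scalerBr opprB addrC subrK scalerA.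
    by rewrite -scaler_suml -/a mul_mpolyC scalerA mulVf // scale1r.
  apply/idealMl/idealB => //; elim/big_ind: _ => [|x y|t' _].
  - exact: ideal0.
  - exact: idealD.
  - exact: idealMl.
rewrite -['X_t](subrK (pt_coord P t *: 'X_(pt_base P t))); apply: idealD; first exact: Qy.
by rewrite -mul_mpolyC; apply: idealMl.
Qed.

Variables (s : nat) (P : 'I_s -> proj K n) (m : 'I_s -> nat) (c : 'I_n.+1 -> K).
Local Notation fat := (ideal_cap (fun j => ideal_exp (proj_ideal (P j)) (m j))).
Local Notation h := (linform c).
Hypothesis c_general : forall j, \sum_t c t * proj_vec (P j) 0 t != 0.

Lemma fat_regular f : fat (h * f) -> fat f.
Proof.
move=> /ideal_capP hf; apply/ideal_capP => j; have := hf j; apply: ideal_exp_primary.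
- exact: pt_cone.
- exact: pt_cone_prop.
- by [].
- exact: pt_block_deg.
- exact: expansion_linform_neq0.
Qed.

(** Each variable is, modulo [h], in the ideal of every point, so a monomial of
    degree the total multiplicity distributes its variables over the points. *)
Lemma monomial_mem_cap (L : seq 'I_s) (e : 'X_{1..n.+1}) : (size L <= mdeg e)%N ->
  ideal_add1 (ideal_cap (fun j => ideal_exp (proj_ideal (P j)) (count_mem j L))) h
    'X_[e].
Proof.
elim: L e => [|j L IHL] e le_e.
  by apply/ideal_add1P; exists 0; apply/ideal_capP => j; apply: ideal_exp0.
have [t et] : exists t, e t != 0%N.
  apply: contrapT => /forallNP e0; move: le_e; rewrite mdegE big1 // => t _.
  by apply/eqP/negPn/negP/e0.
have le1 : (U_(t) <= e)%MM by rewrite lep1mP.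
have /ideal_add1P[q Lq] : ideal_add1
    (ideal_cap (fun j => ideal_exp (proj_ideal (P j)) (count_mem j L))) h 'X_[e - U_(t)].
  by apply: IHL; move: le_e; rewrite -{1}(submK le1) mdegD mdeg1 addn1.
have /ideal_add1P[q' Pq'] := mem_proj_ideal_add1 t (c_general j).
apply/ideal_add1P; rewrite -{1}(submK le1) mpolyXD.
exists ('X_t * q + q' * ('X_[e - U_(t)] - h * q)); apply/ideal_capP => j'.
have -> : 'X_[e - U_(t)] * 'X_t - h * ('X_t * q + q' * ('X_[e - U_(t)] - h * q)) =
  ('X_t - h * q') * ('X_[e - U_(t)] - h * q) by ring.
have -> : count_mem j' (j :: L) = ((j == j') + count_mem j' L)%N by [].
case: eqP => [<-|_]; last by apply: idealMl; apply: Lq.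
by apply: ideal_expM; [apply: ideal_exp1 | apply: Lq].
Qed.

Lemma monomial_mem_fat : exists D, forall e : 'X_{1..n.+1}, (D <= mdeg e)%N ->
  ideal_add1 fat h 'X_[e].
Proof.
pose B := \max_j m j; pose L := flatten (nseq B (enum 'I_s)).
have countL j : count_mem j L = B.
  rewrite /L; elim: (B) => //= b IHb.
  by rewrite count_cat IHb count_uniq_mem ?enum_uniq // mem_enum.
exists (size L) => e /monomial_mem_cap/ideal_add1P[q Hq].
apply/ideal_add1P; exists q; apply/ideal_capP => j; have := Hq j; rewrite countL.
by apply: ideal_exp_le; apply: (leq_bigmax j).
Qed.

(** The section vanishes in large degrees by [monomial_mem_fat], and it is nonzero in
    degree 0 because neither [h] nor the elements of the ideal have constant terms. *)
Lemma fat_top_degree (j0 : 'I_s) : (0 < m j0)%N -> exists rho : int,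
  (exists2 f, whomog std rho f & ~ ideal_add1 fat h f) /\
  forall (a : int) f, rho < a -> whomog std a f -> ideal_add1 fat h f.
Proof.
move=> mj0; have [D HD] := monomial_mem_fat.
pose bad d := `[< exists2 f, whomog std d%:Z f & ~ ideal_add1 fat h f >].
have bad0 : bad 0%N.
  apply/asboolP; exists 1; first by rewrite -(mpolyC1 n.+1 K); apply: whomogC.
  move=> /ideal_add1P[q /(_ j0)/(ideal_exp_mcoeff0 (pt_cone _) (@pt_cone_prop _)
    (pt_weight _) (@pt_block_deg _) mj0)/eqP].
  rewrite mcoeffB rmorphM /= raddf_sum big1 ?mul0r ?subr0 => [|t _]; last first.
    by rewrite /= mcoeffZ mcoeffX mnm1_eq0 mulr0.
  by rewrite mcoeff1 eqxx oner_eq0.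
have bad_le d : bad d -> (d <= D)%N.
  move=> /asboolP[f Hf nf]; rewrite leqNgt; apply/negP => lt; apply: nf.
  rewrite [f]mpolyE big_seq; elim/big_ind: _ => [|x y|e ef].
  - exact: ideal0.
  - exact: idealD.
  rewrite -mul_mpolyC; apply/idealMl/HD; have := Hf e ef; rewrite std_wdeg => -[->].
  exact: ltnW.
case: (ex_maxnP (ex_intro bad 0%N bad0) bad_le) => r /asboolP badr r_max.
exists r%:Z; split=> // a f lt Hf; apply: contrapT => nf.
case: a lt Hf => [a|a] // lt Hf.
have /r_max : bad a by apply/asboolP; exists f.
by move: lt; lia.
Qed.

End FatPoints.

(** * Fat points in a product *)

Lemma is_maximum_ext (A B : int -> Prop) r :
  (forall a, A a <-> B a) -> is_maximum A r -> is_maximum B r.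
Proof. by move=> AB [Ar leA]; split=> [|a /AB]; [apply/AB | apply: leA]. Qed.

Section MultiProjective.
Variables (K : fieldType) (k : nat) (n : 'I_k -> nat).
Local Notation N := #|xvar n|.
Local Notation R := {mpoly K[N]}.
Local Notation mw := (@multi_weight k n).
Local Notation cone P := (fun x : 'I_N -> K =>
  exists v : forall i, 'rV[K]_(n i).+1, (forall i, represents (v i) (P i)) /\
    forall t, x t = v (tag (enum_val t)) 0 (tagged (enum_val t))).

Definition var_index (i : 'I_k) (x : 'I_(n i).+1) : 'I_N :=
  enum_rank (Tagged (fun i => 'I_(n i).+1) x : xvar n).

Definition var_block (t : 'I_N) : 'I_k := tag (enum_val t).

Lemma var_block_index i x : var_block (@var_index i x) = i.
Proof. by rewrite /var_block enum_rankK. Qed.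

Lemma var_index_inj i : injective (@var_index i).
Proof.
move=> x y /enum_rank_inj /eqP; rewrite -tag_eqE /tag_eq eqxx /= => /eqP.
by rewrite tagged_asE.
Qed.

Lemma var_indexK t : @var_index (tag (enum_val t)) (tagged (enum_val t)) = t.
Proof. by apply: enum_val_inj; rewrite enum_rankK; case: (enum_val t). Qed.

Lemma var_index_block l t : var_block t = l -> exists x : 'I_(n l).+1, var_index x = t.
Proof. by move=> <-; exists (tagged (enum_val t)); apply: var_indexK. Qed.

Definition mpt_base (P : multiproj K n) (t : 'I_N) : 'I_N :=
  var_index (proj_base (P (var_block t))).
Definition mpt_coord (P : multiproj K n) (t : 'I_N) : K :=
  proj_vec (P (tag (enum_val t))) 0 (tagged (enum_val t)).
Local Notation mpt_expansion P := (expansion (mpt_base P) (mpt_coord P)).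

Lemma mpt_base_block P t : var_block (mpt_base P t) = var_block t.
Proof. exact: var_block_index. Qed.

Lemma mpt_coord_index P i (x : 'I_(n i).+1) : mpt_coord P (var_index x) = proj_vec (P i) 0 x.
Proof. by rewrite /mpt_coord /var_index enum_rankK. Qed.

Lemma mpt_cone P : cone P (mpt_coord P).
Proof. by exists (fun i => proj_vec (P i)); split=> // i; apply: proj_vecP. Qed.

Lemma mpt_cone_prop P x :
  cone P x -> forall t, x t = mpt_coord P t * x (mpt_base P t).
Proof.
move=> [u [Pu xu]] t; rewrite !xu /mpt_base /var_index enum_rankK /=.
exact: represents_prop.
Qed.

Lemma mpt_weight P t : mw (mpt_base P t) = mw t.
Proof. by rewrite /multi_weight -/(var_block _) mpt_base_block. Qed.

Lemma mpt_block_deg P (m m' : 'X_{1..N}) : mnm_wdeg mw m = mnm_wdeg mw m' ->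
  \prod_t ('X_(mpt_base P t) : R) ^+ m t = \prod_t 'X_(mpt_base P t) ^+ m' t.
Proof.
move=> eqd.
have degE (e : 'X_{1..N}) i :
    (mnm_wdeg mw e) 0 i = (\sum_(t | var_block t == i) e t)%N%:Z.
  rewrite /mnm_wdeg summxE -natz natr_sum [RHS]big_mkcond; apply: eq_bigr => t _.
  rewrite mulmxnE /multi_weight mxE eqxx /= [i == _]eq_sym -/(var_block t).
  by case: eqP; rewrite ?mul0rn.
have prodE (e : 'X_{1..N}) : \prod_t ('X_(mpt_base P t) : R) ^+ e t =
    \prod_i 'X_(var_index (proj_base (P i))) ^+ (\sum_(t | var_block t == i) e t)%N.
  rewrite (partition_big var_block predT) //=; apply: eq_bigr => i _.
  by rewrite -prodrXr; apply: eq_bigr => t /eqP <-.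
rewrite !prodE; apply: eq_bigr => i _; congr (_ ^+ _).
by have := congr1 (fun g : 'rV_k => g 0 i) eqd; rewrite !degE => -[].
Qed.

Lemma multiproj_ideal_exp P d f :
  ideal_exp (multiproj_ideal P) d f <-> principal ('X^d) (mpt_expansion P f).
Proof.
exact: (ideal_exp_expansion (mpt_cone P) (@mpt_cone_prop P) (mpt_weight P)
  (@mpt_block_deg P)).
Qed.

Variable l : 'I_k.
Local Notation incl := (incl_hom K (@var_index l)).
Local Notation retr := (retr_hom K (@var_index l)).

Lemma var_index_out t : (forall x : 'I_(n l).+1, var_index x != t) <-> var_block t != l.
Proof.
split=> [H|H x]; last by apply: contra_neq H => <-; apply: var_block_index.
by apply/eqP => /var_index_block[x xt]; have := H x; rewrite xt eqxx.
Qed.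

Lemma mpt_base_index P x : mpt_base P (@var_index l x) = var_index (pt_base (P l) x).
Proof. by rewrite /mpt_base var_block_index. Qed.

Lemma incl_ideal_exp P d f :
  ideal_exp (proj_ideal (P l)) d f -> ideal_exp (multiproj_ideal P) d (incl f).
Proof.
move=> /proj_ideal_exp Hf; apply/multiproj_ideal_exp.
rewrite (expansion_incl (mpt_base_index P) (mpt_coord_index P (i := l))).
by have := principal_preim (map_poly incl) Hf; rewrite /= map_polyXn.
Qed.

Lemma retr_ideal_exp P d f :
  ideal_exp (multiproj_ideal P) d f -> ideal_exp (proj_ideal (P l)) d (retr f).
Proof.
move=> /multiproj_ideal_exp Hf; apply/proj_ideal_exp.
rewrite (expansion_retr (@var_index_inj l) (mpt_base_index P) (mpt_coord_index P (i := l))).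
  by have := principal_preim (map_poly retr) Hf; rewrite /= map_polyXn.
by move=> t /var_index_out Ht; apply/var_index_out; rewrite mpt_base_block.
Qed.

End MultiProjective.

Section RowCoordinate.
Variables (k : nat) (l : 'I_k).

Definition row_coord (d : 'rV[int]_k) : int := d 0 l.

Lemma row_coord_is_additive : {morph row_coord : x y / x - y >-> x - y}.
Proof. by move=> x y; rewrite /row_coord !mxE. Qed.

HB.instance Definition _ :=
  GRing.isZmodMorphism.Build 'rV[int]_k int row_coord row_coord_is_additive.

End RowCoordinate.

Section FactorRegularity.
Variables (K : closedFieldType) (k : nat) (n : 'I_k -> nat) (s : nat).
Variables (P : 'I_s -> multiproj K n) (m : 'I_s -> nat) (l : 'I_k) (j0 : 'I_s).
Hypothesis charK : [pchar K] =i pred0.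
Hypothesis m_j0 : (0 < m j0)%N.
Local Notation N := #|xvar n|.
Local Notation mw := (@multi_weight k n).
Local Notation std := (@std_weight (n l).+1).
Local Notation phi := (row_coord l).
Local Notation fatS := (fat_proj_ideal P m l).
Local Notation fatR := (fat_ideal P m).
Local Notation ix := (@var_index k n l).
Local Notation incl := (incl_hom K ix).
Local Notation retr := (retr_hom K ix).

Lemma row_coord_weight t : phi (mw t) = (var_block t == l)%:R.
Proof. by rewrite /row_coord /multi_weight mxE eqxx eq_sym. Qed.

Lemma incl_homog a f : whomog std a f -> whomog (phi \o mw) a (incl f).
Proof.
apply: whomog_rmorph => [b|x]; first exact: incl_homC.
rewrite incl_homX; have -> : std x = (phi \o mw) (ix x).
  by rewrite /= row_coord_weight var_block_index eqxx.
exact: whomogU.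
Qed.

(** Variables of the other factors do not change the degree in the [l]-th one, so
    the top degree of the section is already seen in the [l]-th factor. *)
Lemma mem_incl_top c (a : int) (f : {mpoly K[N]}) :
  (forall p, whomog std a p -> ideal_add1 fatS (linform c) p) ->
  whomog (phi \o mw) a f -> ideal_add1 fatR (linform (extend_coef ix c)) f.
Proof.
move=> top Hf; set Q := ideal_add1 _ _.
have Qincl p : ideal_add1 fatS (linform c) p -> Q (incl p).
  move=> /ideal_add1P[q /ideal_capP Iq]; apply/ideal_add1P; exists (incl q).
  rewrite -incl_linform -rmorphM -rmorphB; apply/ideal_capP => j.
  by apply: incl_ideal_exp; apply: Iq.
rewrite [f]mpolyE big_seq; elim/big_ind: _ => [|x y|e ef].
- exact: ideal0.
- exact: idealD.
rewrite -mul_mpolyC; apply: idealMl; rewrite mpolyXE_id.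
rewrite (bigID (mem [set ix x | x : 'I_(n l).+1])) /= mulrC; apply: (@idealMl _ Q).
pose e' : 'X_{1..(n l).+1} := [multinom e (ix x) | x < (n l).+1].
have -> : \prod_(t in [set ix x | x : 'I_(n l).+1]) ('X_t : {mpoly K[N]}) ^+ e t =
    incl 'X_[e'].
  rewrite big_imset /=; last by move=> x y _ _; apply: var_index_inj.
  rewrite mpolyXE_id rmorph_prod; apply: eq_big => [x|x _]; first by rewrite inE.
  by rewrite rmorphXn incl_homX mnmE.
apply/Qincl/top; have <- : mnm_wdeg std e' = a; last exact: whomogX.
rewrite -(Hf e ef) /mnm_wdeg (bigID (mem [set ix x | x : 'I_(n l).+1])) /=.
rewrite [X in _ + X]big1 ?addr0 => [|t nt].
  rewrite big_imset /=; last by move=> x y _ _; apply: var_index_inj.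
  apply: eq_big => [x|x _]; first by rewrite inE.
  by rewrite row_coord_weight var_block_index eqxx mnmE.
rewrite row_coord_weight; case: eqP => [/var_index_block[x xt]|_]; last exact: mul0rn.
by case/negP: nt; rewrite -xt imset_f.
Qed.

Lemma factor_regularity : exists rho : int,
  CM_regularity (quot_gmodule std fatS) rho /\
  is_maximum (fun a => exists (i : nat) (d : 'rV[int]_k),
    d 0 l = a /\ Tor_neq0 mw (quot_gmodule mw fatR) i (d + delta_mx 0 l *+ i)) rho.
Proof.
have [c [c0 cg]] := general_linear_form charK
  (fun j => (proj_vecP (P j l)).2 : proj_vec (P j l) != 0).
have [rho [[f Hf nf] top]] := fat_top_degree (P := fun j => P j l) cg m_j0.
have hreg := fat_regular (P := fun j => P j l) (m := m) cg.
exists rho; split.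
  apply: is_maximum_ext (Tor_maximum (phi := idfun) (w := std) (I := fatS)
    (Q := ideal_add1 fatS (linform c)) (f := f) c0 _ _ _ hreg top _ _ _ Hf nf).
  - move=> a; split=> [[i [g [/= -> Hg]]]|[i Hi]]; first by exists i.
    by exists i, (a + i%:Z).
  - by [].
  - by right.
  - move=> g p /ideal_capP Ip; apply/ideal_capP => j.
    by apply: proj_ideal_wcomp; apply: Ip.
  - by move=> p Ip; apply: mem_ideal_gen; left.
  - by apply: mem_ideal_gen; right.
  - by [].
have deltaE i : phi (delta_mx 0 l *+ i) = i%:Z.
  by rewrite /row_coord mulmxnE mxE !eqxx -natz.
have ix_inj := @var_index_inj k n l.
pose Q := ideal_preim retr (ideal_add1 fatS (linform c)).
have QE p : Q p = ideal_add1 fatS (linform c) (retr p) by [].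
apply: is_maximum_ext (Tor_maximum (phi := phi) (w := mw) (I := fatR) (Q := Q)
  (c := extend_coef ix c) (t0 := ix ord0) (f := incl f) _ _ _ _ _ _ _ _ _ _ _).
- move=> a; split=> [[i [g [ga Hg]]]|[i [d [da Hd]]]].
    exists i, (g - delta_mx 0 l *+ i); rewrite subrK; split=> //.
    by rewrite -/(row_coord l _) raddfB /= ga deltaE addrK.
  exists i, (d + delta_mx 0 l *+ i); split=> //.
  by rewrite raddfD /= deltaE /row_coord da.
- by rewrite extend_coefE.
- move=> t /extend_coef_neq0[x <-] /=.
  by rewrite row_coord_weight var_block_index eqxx.
- by move=> t /=; rewrite row_coord_weight; case: eqP; [right | left].
- move=> g p /ideal_capP Ip; apply/ideal_capP => j.
  apply: (ideal_exp_wcomp (mpt_cone (P j)) (@mpt_cone_prop _ _ _ (P j))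
    (mpt_weight (P j)) (@mpt_block_deg _ _ _ (P j))).
  exact: Ip.
- move=> p /ideal_capP hp; apply/ideal_capP => j.
  apply: (ideal_exp_primary (mpt_cone (P j)) (@mpt_cone_prop _ _ _ (P j))
    (mpt_weight (P j)) (@mpt_block_deg _ _ _ (P j)) _ (hp j)).
  rewrite -incl_linform.
  rewrite (expansion_incl (mpt_base_index (P j)) (mpt_coord_index (P j) (i := l))).
  rewrite coef_map; apply: contraNneq (expansion_linform_neq0 (cg j)) => /= e0.
  by rewrite -[X in X == _](incl_homK ix_inj) e0 rmorph0.
- by move=> a p lt; apply: mem_incl_top => q; apply: top.
- move=> p /ideal_capP Ip; rewrite QE; apply: mem_ideal_gen; left.
  by apply/ideal_capP => j; apply: retr_ideal_exp; apply: Ip.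
- by rewrite QE -incl_linform incl_homK //; apply: mem_ideal_gen; right.
- move=> t; rewrite [X in X = 0 -> _]row_coord_weight => /eqP.
  rewrite pnatr_eq0 eqb0 => nt.
  by rewrite QE retr_homX0; [apply: ideal0 | apply/var_index_out].
- exact: incl_homog.
- by rewrite QE incl_homK.
Qed.

End FactorRegularity.

Theorem theorem4p2 (K : closedFieldType) (charK : [pchar K] =i pred0)
    (k : nat) (n : 'I_k -> nat) (n_gt0 : forall i, (0 < n i)%N)
    (s : nat) (s_gt0 : (0 < s)%N) (P : 'I_s -> multiproj K n)
    (P_distinct : forall j j', (forall i, P j i = P j' i) -> j = j')
    (m : 'I_s -> nat) (m_gt0 : forall j, (0 < m j)%N) :
  exists r : 'rV[int]_k,
    (forall i : 'I_k,
       CM_regularity (quot_gmodule (@std_weight (n i).+1) (fat_proj_ideal P m i))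
         (r 0 i)) /\
    resolution_regularity (@multi_weight k n)
      (quot_gmodule (@multi_weight k n) (fat_ideal P m)) r.
Proof.
have [r Hr] := fin_all_exists (fun l =>
  factor_regularity P l charK (m_gt0 (Ordinal s_gt0))).
exists (\row_l r l); split=> l; rewrite mxE; first by case: (Hr l).
by case: (Hr l).
Qed.
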